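(* Let $m\in(0,\infty)$ and $\lambda_L,\lambda_R\in[0,1)$. Let $\mu_{L,R}$ denote the unique stationary measure of the boundary driven SIP$(m)$ on $\{1,\dots,N\}$ with generator $\mathcal L$. Then for all $n\ge1$ and $x_1,\dots,x_n\in\{1,\dots,N\}$, $$\int D\Big(\sum_{i=1}^n\delta_{x_i},\eta\Big)\mu_{L,R}(d\eta)\ \ge\ \prod_{i=1}^n\int D(\delta_{x_i},\eta)\,\mu_{L,R}(d\eta).$$ In particular, the variables $\eta_x$, $x\in\{1,\dots,N\}$, are positively correlated under $\mu_{L,R}$.
   Context: The boundary driven SIP$(m)$ on the chain $\{1,\dots,N\}$ is the Markov process on $\mathbb N^{\{1,\dots,N\}}$ ($\mathbb N=\{0,1,2,\dots\}$) with generator $\mathcal L=\mathcal L_1+\mathcal L_N+\mathcal L_{bulk}$, where $$\mathcal L_{bulk}f(\eta)=\sum_{x=1}^{N-1}\Big[2\eta_x(m+2\eta_{x+1})\big(f(\eta^{x,x+1})-f(\eta)\big)+2\eta_{x+1}(m+2\eta_x)\big(f(\eta^{x+1,x})-f(\eta)\big)\Big],$$ $$\mathcal L_1f(\eta)=d_L(\eta_1)(f(\eta-\delta_1)-f(\eta))+b_L(\eta_1)(f(\eta+\delta_1)-f(\eta)),$$ $$\mathcal L_Nf(\eta)=d_R(\eta_N)(f(\eta-\delta_N)-f(\eta))+b_R(\eta_N)(f(\eta+\delta_N)-f(\eta)),$$ with $\eta^{x,y}$ obtained from $\eta$ by moving one particle from $x$ to $y$, and rates, for $\alpha\in\{L,R\}$,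 $$d_\alpha(n)=\frac{n}{1-\lambda_\alpha},\qquad b_\alpha(n)=\Big(\frac m2+n\Big)\frac{\lambda_\alpha}{1-\lambda_\alpha}.$$ This process has a unique stationary probability measure, denoted $\mu_{L,R}$. $D(\xi,\eta)=\prod_{x=1}^ND(\xi_x,\eta_x)$ with $D(k,n)=\frac{n!}{(n-k)!}\frac{\Gamma(m/2)}{\Gamma(m/2+k)}$ for $k\le n$ and $D(k,n)=0$ for $k>n$. $\sum_{i=1}^n\delta_{x_i}$ is the configuration $\xi$ with $\xi_x=\sum_iI(x_i=x)$. *)

(* Defs.v *)
From HB Require Import structures.
From mathcomp Require Import all_boot all_order all_algebra.
From mathcomp Require Import all_classical all_reals all_analysis.

Set Implicit Arguments.
Unset Strict Implicit.
Unset Printing Implicit Defensive.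

Import Order.TTheory GRing.Theory Num.Theory.
Import numFieldNormedType.Exports.

Local Open Scope classical_set_scope.
Local Open Scope ring_scope.

(* The chain with N.+1 >= 1 sites: site k of {1, ..., N.+1} is the ordinal of
   value k.-1, so the left and right ends are ord0 and ord_max. *)
Notation site N := 'I_N.+1.

(* An alias, so that the discrete sigma-algebra below is not imposed on every
   finite function type. *)
Definition conf (N : nat) := {ffun site N -> nat}.

HB.instance Definition _ N := Choice.on (conf N).
HB.instance Definition _ N := isPointed.Build (conf N) [ffun=> 0%N].
HB.instance Definition _ N := @isMeasurable.Build default_measure_display
  (conf N) discrete_measurable discrete_measurable0
  discrete_measurableC discrete_measurableU.

Definition delta N (x : site N) : conf N := [ffun z => nat_of_bool (x == z)].

Definition delta_sum N n (x : 'I_n -> site N) : conf N :=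
  [ffun z => (\sum_(i < n) delta (x i) z)%N].

Definition add_at N (x : site N) (eta : conf N) : conf N :=
  [ffun z => (eta z + delta x z)%N].

(* Subtraction is truncated; every rate of a jump removing a particle from an
   empty site is 0. *)
Definition remove_at N (x : site N) (eta : conf N) : conf N :=
  [ffun z => (eta z - delta x z)%N].

Definition move N (x y : site N) (eta : conf N) : conf N :=
  add_at y (remove_at x eta).

Section sip.
Context {R : realType}.
Implicit Types (m lam : R) (N n : nat).

Definition death_rate lam n : R := n%:R / (1 - lam).

Definition birth_rate m lam n : R := (m / 2 + n%:R) * (lam / (1 - lam)).

Definition gen_boundary N m lam (x : site N) (f : conf N -> R) (eta : conf N)
    : R :=
  death_rate lam (eta x) * (f (remove_at x eta) - f eta) +
  birth_rate m lam (eta x) * (f (add_at x eta) - f eta).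

(* The bond number x : 'I_N joins the sites of value x and x.+1. *)
Definition gen_bulk N m (f : conf N -> R) (eta : conf N) : R :=
  \sum_(x < N)
    let l := widen_ord (leqnSn N) x in let r := lift ord0 x in
    (2 * (eta l)%:R * (m + 2 * (eta r)%:R) * (f (move l r eta) - f eta) +
     2 * (eta r)%:R * (m + 2 * (eta l)%:R) * (f (move r l eta) - f eta)).

Definition gen N m lamL lamR (f : conf N -> R) (eta : conf N) : R :=
  gen_boundary m lamL ord0 f eta + gen_boundary m lamR ord_max f eta +
  gen_bulk m f eta.

(* P t eta is the law at time t of the process started from eta; only t >= 0
   is meaningful. The last clause makes the jump rates of the process those of
   L; they determine the process because the chain with these rates does not
   explode. *)
Record is_markov_semigroup N (L : (conf N -> R) -> conf N -> R)
    (P : R -> conf N -> probability (conf N) R) : Prop := {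
  semigroup0 : forall eta (A : set (conf N)), P 0 eta A = \d_eta A ;
  semigroupD : forall s t eta (A : set (conf N)), 0 <= s -> 0 <= t ->
    P (s + t) eta A = (\int[P s eta]_zeta P t zeta A)%E ;
  semigroup_gen : forall (f : conf N -> R) eta,
    finite_set [set zeta | f zeta != 0] ->
    t^-1 * ((\int[P t eta]_zeta f zeta) - f eta) @[t --> 0^'+] --> L f eta }.

Definition stationary N (P : R -> conf N -> probability (conf N) R)
    (mu : probability (conf N) R) : Prop :=
  forall t (A : set (conf N)), 0 <= t -> (\int[mu]_eta P t eta A)%E = mu A.

Definition Gamma (a : R) : R :=
  \int[lebesgue_measure]_(t in `]0, +oo[) (t `^ (a - 1) * expR (- t)).

Definition dual1 m (k n : nat) : R :=
  if (k <= n)%N then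
    (n`!)%:R / ((n - k)`!)%:R * (Gamma (m / 2) / Gamma (m / 2 + k%:R))
  else 0.

Definition dual N m (xi eta : conf N) : R := \prod_(x < N.+1) dual1 m (xi x) (eta x).

Definition occ N (x : site N) (eta : conf N) : R := (eta x)%:R.

End sip.

(* Main.v *)
Require Import Defs.
From mathcomp Require Import all_boot all_order all_algebra.
From mathcomp Require Import all_classical all_reals all_analysis.
From mathcomp Require Import measurable_realfun ring lra zify.

(* With rho = lam / (1 - lam) at each end, self-duality turns stationarity of mu
   into A h = 0 for h(xi) = \int D(xi, .) dmu, where A lets the particles of xi
   perform the bulk dynamics and be absorbed at rate 1 at the ends with weights
   rho_L, rho_R. The product g(xi) = prod_x u(x)^(xi_x), u(x) = h(delta_x), satisfies
   A g >= 0: the inclusion interaction on a bond adds a multiple of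
   (u(x) - u(x+1))^2 to independent motion. A minimum principle on configurations
   with n particles, by induction on n, gives h >= g.

   Only the generator at time 0 on finitely supported functions is available, so
   int L F dmu = 0 for polynomially bounded F needs an argument. If all sublevel
   sets of G are finite, then f = max(K - G, 0) is finitely supported, and
   stationarity gives sum_(G < K) mu(eta) (P_t f - f)(eta) <= 0; letting t -> 0,
   0 <= int_(G < K) L G dmu. With G = Q V^k, where V is the number of particles and
   Q = sum_x w_x eta_x satisfies L Q = const - 4 m V, this bounds the moments of mu
   one after the other; with G = +-F + eps V^k and eps -> 0 it gives the claim. *)

Set Implicit Arguments.
Unset Strict Implicit.
Unset Printing Implicit Defensive.

Import Order.TTheory GRing.Theory Num.Theory.
Import numFieldNormedType.Exports.

Local Open Scope classical_set_scope.
Local Open Scope ring_scope.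

(** * The Gamma function *)

Section Gamma.
Context {R : realType}.
Implicit Types a t : R.

Let mu := @lebesgue_measure R.
(** Compact intervals exhausting the half-line, so that integration by parts stays away from the
    singularity at 0. With an exponential left end, the boundary term there is at most
    [expR (- (a * n.+1%:R))]. *)
Let itv (n : nat) : set R := `[expR (- n.+1%:R), n.+1%:R].

Let itv_bigcup : \bigcup_n itv n = `]0, +oo[%classic.
Proof.
apply/seteqP; split => x /=.
  move=> [n _]; rewrite /itv /= !in_itv /= andbT => /andP[h _].
  exact: lt_le_trans (expR_gt0 _) h.
rewrite in_itv /= andbT => x0.
exists (Num.truncn (x + x^-1)) => //.
have h : x + x^-1 < (Num.truncn (x + x^-1)).+1%:R by exact: truncnS_gt.
have xV : 0 < x^-1 by rewrite invr_gt0.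
rewrite /itv /= in_itv /=; apply/andP; split; last by apply: ltW; lra.
rewrite expRN -[leRHS]invrK lef_pV2 ?posrE ?expR_gt0//.
apply: le_trans (expR_ge1Dx _); lra.
Qed.

Let itv_nd : nondecreasing_seq itv.
Proof.
move=> p q pq; rewrite subsetEset; apply: subset_itvScc; rewrite bnd_simp.
  by rewrite ler_expR lerN2 ler_nat.
by rewrite ler_nat.
Qed.

Let integrand a t := t `^ a * expR (- t).

Let integrand_ge0 a t : 0 <= integrand a t.
Proof. by rewrite mulr_ge0 ?powR_ge0 ?expR_ge0. Qed.

Let measurable_integrand a (D : set R) : measurable_fun D (integrand a).
Proof.
apply: measurable_funTS; apply: measurable_funM; first exact: measurable_powR.
exact: measurableT_comp.
Qed.

Let itv_lt n : expR (- n.+1%:R) < n.+1%:R :> R.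
Proof.
apply: (@lt_le_trans _ _ 1); last by rewrite ler1n.
by rewrite expR_lt1 oppr_lt0 ltr0n.
Qed.

Let is_derive_expRN (x : R) : is_derive x 1 (fun t => - expR (- t)) (expR (- x)).
Proof.
have -> : (fun t => - expR (- t)) = - (expR \o (fun t : R => - t)) by [].
by apply: is_derive_eq; rewrite /GRing.scale /= ; ring.
Qed.

(** [t^a] is integrated against the derivative of [- expR (- t)]. The identity lives in the extended
    reals, so that the limit in [n] can be taken before the limiting integrals are known to be
    finite. *)
Let by_parts a n : 0 < a ->
  (\int[mu]_(t in itv n) (integrand a t)%:E =
  (integrand a (expR (- n.+1%:R)) - integrand a n.+1%:R)%:E +
  a%:E * \int[mu]_(t in itv n) (integrand (a - 1) t)%:E)%E.
Proof.
move=> a0.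
have pos x : x \in itv n -> 0 < x.
  rewrite inE /itv /= in_itv /= => /andP[h _]; exact: lt_le_trans (expR_gt0 _) h.
have posoo x : x \in `]expR (- n.+1%:R), n.+1%:R[ -> 0 < x :> R.
  by rewrite in_itv /= => /andP[h _]; exact: lt_trans (expR_gt0 _) h.
have contp (b x : R) : 0 < x -> {for x, continuous (fun t : R => t `^ b)}.
  move=> x0; apply: differentiable_continuous; apply/derivable1_diffP.
  by apply: derivable_powR; rewrite in_itv /= andbT.
have conte (x : R) : {for x, continuous (fun t : R => - expR (- t))}.
  apply: differentiable_continuous; apply/derivable1_diffP.
  by have [] := is_derive_expRN x.
have := @integration_by_parts R (fun t : R => t `^ a) (fun t => - expR (- t))
  (fun t => a * t `^ (a - 1)) (fun t => expR (- t)) _ _ (itv_lt n).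
move=> -> //; last 6 first.
- apply/subspace_continuousP => x xi; apply: cvg_within_filter; apply: cvgM; first exact: cvg_cst.
  by apply: contp; apply: pos; rewrite inE.
- split => [x xi||].
  + by apply: derivable_powR; rewrite in_itv /= andbT posoo.
  + by apply: cvg_at_right_filter; apply: contp; exact: expR_gt0.
  + by apply: cvg_at_left_filter; apply: contp.
- by move=> x /posoo x0; rewrite powR_derive1// in_itv /= andbT.
- apply: continuous_subspaceT => x; apply: continuous_comp; first exact: continuousN.
  exact: continuous_expR.
- split => [x xi||].
  + by have [] := is_derive_expRN x.
  + by apply: cvg_at_right_filter; apply: conte.
  + by apply: cvg_at_left_filter; apply: conte.
- by move=> x _; rewrite derive1E; have [_ ->] := is_derive_expRN x.
rewrite -ge0_integralZl_EFin//; last 4 first.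
- exact: measurable_itv.
- by move=> x _; rewrite lee_fin integrand_ge0.
- by apply/measurable_EFinP; exact: measurable_integrand.
- exact: ltW.
rewrite (_ : (\int[_]_(_ in _) _)%E =
  (- \int[mu]_(t in itv n) (a%:E * (integrand (a - 1) t)%:E))%E); last first.
  rewrite -integral_ge0N; last first.
    by move=> x _; rewrite -EFinM lee_fin mulr_ge0 ?integrand_ge0 ?ltW.
  by apply: eq_integral => x _; rewrite -EFinM -EFinN /integrand mulrN mulrA.
rewrite oppeK; congr (_%:E + _)%E.
rewrite /integrand; ring.
Qed.

(** With s = t / (2a), the bound ln s <= s gives s^a <= exp (a s) = exp (t / 2). *)
Let powR_le_expR a (t : R) : 0 < a -> 0 < t -> t `^ a <= (2 * a) `^ a * expR (t / 2).
Proof.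
move=> a0 t0.
have h : 0 < t / (2 * a) by rewrite divr_gt0// mulr_gt0.
rewrite -[in leLHS](@divfK _ (2 * a) _ t) ?gt_eqF ?mulr_gt0//.
rewrite [in leLHS]powRM; [|exact: ltW|by rewrite mulr_ge0// ltW].
rewrite [leLHS]mulrC; apply: ler_wpM2l; first exact: powR_ge0.
rewrite [leLHS]/powR gt_eqF// ler_expR.
apply: (@le_trans _ _ (a * (t / (2 * a)))); first by rewrite ler_pM2l//; exact/ltW/ln_sublinear.
by rewrite (_ : a * _ = t / 2)//; field; rewrite gt_eqF.
Qed.

Let integrand_le a t : 0 < a -> 0 < t -> integrand a t <= (2 * a) `^ a * expR (- (t / 2)).
Proof.
move=> a0 t0; rewrite /integrand.
have -> : expR (- t) = expR (- (t / 2)) * expR (- (t / 2)) by rewrite -expRD; congr expR; field.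
rewrite mulrA ler_wpM2r ?expR_ge0//.
have -> : (2 * a) `^ a = (2 * a) `^ a * expR (t / 2) * expR (- (t / 2)).
  by rewrite -mulrA expRxMexpNx_1 mulr1.
by rewrite ler_wpM2r ?expR_ge0// powR_le_expR.
Qed.

Let boundary_cvg0 a : 0 < a ->
  integrand a (expR (- n.+1%:R)) - integrand a n.+1%:R @[n --> \oo] --> (0 : R).
Proof.
move=> a0.
have nyR : (n.+1%:R : R) @[n --> \oo] --> +oo.
  by apply/cvgryPge => A; near=> n; apply: (@le_trans _ _ n%:R);
     [near: n; exact: nbhs_infty_ger | rewrite ler_nat].
have expN c : 0 < c -> expR (- (c * n.+1%:R)) @[n --> \oo] --> (0 : R).
  move=> c0; apply: (@cvg_comp _ _ _ (fun n : nat => c * n.+1%:R) (fun x : R => expR (- x)));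
    last exact: cvgr_expR.
  apply: (@cvg_comp _ _ _ (fun n : nat => n.+1%:R : R) (fun x : R => c * x)); first exact: nyR.
  by apply: gt0_cvgMry.
rewrite -[X in _ --> X]subr0; apply: cvgB.
  apply: (@squeeze_cvgr _ _ _ _ (cst 0) (fun n => expR (- (a * n.+1%:R)))); last 2 first.
  - exact: cvg_cst.
  - exact: expN.
  near=> n; rewrite integrand_ge0 /=.
  have -> : - (a * n.+1%:R) = (- n.+1%:R) * a by ring.
  rewrite expRM ler_piMr ?powR_ge0//.
apply: (@squeeze_cvgr _ _ _ _ (cst 0)
  (fun n => (2 * a) `^ a * expR (- (2^-1 * n.+1%:R)))); last 2 first.
- exact: cvg_cst.
- by rewrite -[X in _ --> X](mulr0 ((2 * a) `^ a)); apply: cvgMr; exact: expN.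
near=> n; rewrite integrand_ge0 /= mulrC.
by rewrite [2^-1 * _]mulrC mulrC integrand_le.
Unshelve. all: by end_near. Qed.

Let egamma a := (\int[mu]_(t in `]0%R, +oo[) (integrand (a - 1) t)%:E)%E.

Let egamma_cvg a :
  (\int[mu]_(t in itv n) (integrand (a - 1) t)%:E)%E @[n --> \oo] --> egamma a.
Proof.
rewrite /egamma -itv_bigcup.
apply: ge0_nondecreasing_set_cvg_integral => //.
- by move=> n; exact: measurable_itv.
- by move=> n; apply/measurable_EFinP; exact: measurable_integrand.
- by move=> n x _; rewrite lee_fin integrand_ge0.
Qed.

Let egammaS a : 0 < a -> egamma (a + 1) = (a%:E * egamma a)%E.
Proof.
move=> a0; have h := @egamma_cvg (a + 1); rewrite addrK in h.
rewrite (eq_cvg _ _ (fun n => by_parts n a0)) in h.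
apply: (cvg_unique _ h) => //=.
rewrite -[X in _ --> X]add0e; apply: cvgeD => //.
- by apply: cvg_EFin; [exact: nearW | exact: boundary_cvg0].
- by apply: cvgeZl => //; exact: egamma_cvg.
Qed.

(** For [a < 1] the integrand is unbounded near 0. By [egammaS] it is enough to treat [a + 1], where
    [integrand_le] gives domination by a multiple of the exponential density of rate 1/2. *)
Let egamma_lty a : 0 < a -> (egamma a < +oo)%E.
Proof.
move=> a0.
suff : (egamma (a + 1) < +oo)%E.
  rewrite egammaS//; have : (0 <= egamma a)%E.
    by apply: integral_ge0 => x _; rewrite lee_fin integrand_ge0.
  case: (egamma a) => [r _ _|_|//]; first exact: ltry.
  by rewrite gt0_muley ?lte_fin.
rewrite /egamma addrK.
have m2 : measurable_fun setT (fun t => (exponential_pdf 2^-1 t)%:E : \bar R).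
  by apply/measurable_EFinP; apply: measurable_exponential_pdf; rewrite invr_ge0.
have p2 (t : R) : (0 <= (exponential_pdf 2^-1 t)%:E)%E.
  by rewrite lee_fin exponential_pdf_ge0.
apply: (@le_lt_trans _ _ (\int[mu]_(t in `]0%R, +oo[)
  (((2 * a) `^ a * 2)%:E * (exponential_pdf 2^-1 t)%:E)))%E.
  apply: ge0_le_integral => //.
  - by move=> x _; rewrite lee_fin integrand_ge0.
  - by apply/measurable_EFinP; exact: measurable_integrand.
  - by apply: measurable_funTS; apply: measurable_funeM.
  - move=> t; rewrite /= in_itv /= andbT => t0; rewrite -EFinM lee_fin.
    rewrite exponential_pdfE; last exact: ltW.
    rewrite -mulrA mulVKf// mulNr [2^-1 * t]mulrC.
    exact: integrand_le.
rewrite ge0_integralZl_EFin//; last 2 first.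
- exact: measurable_funTS.
- by rewrite mulr_ge0// powR_ge0.
rewrite lte_mul_pinfty// ?lee_fin ?mulr_ge0 ?powR_ge0//.
apply: (@le_lt_trans _ _ (\int[mu]_t (exponential_pdf 2^-1 t)%:E)%E).
  by apply: ge0_subset_integral.
by rewrite integral_exponential_pdf ?ltry ?invr_gt0.
Qed.

Lemma GammaS a : 0 < a -> Gamma (a + 1) = a * Gamma a.
Proof.
move=> a0; rewrite /Gamma /Rintegral.
have := egammaS a0; rewrite /egamma /integrand => ->.
rewrite fineM// ge0_fin_numE; first exact: egamma_lty.
by apply: integral_ge0 => x _; rewrite lee_fin integrand_ge0.
Qed.

Lemma Gamma_gt0 a : 0 < a -> 0 < Gamma a.
Proof.
move=> a0; rewrite /Gamma /Rintegral fine_gt0//.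
have -> /= := egamma_lty a0; rewrite andbT.
(* A lower bound for the integrand on [1, 2]; the minimum covers both signs of [a - 1]. *)
pose c := Num.min (1 : R) (2 `^ (a - 1)) * expR (- 2).
have c0 : 0 < c by rewrite mulr_gt0 ?expR_gt0// lt_min ltr01 powR_gt0.
apply: (@lt_le_trans _ _ (\int[mu]_(t in `[1%R, 2%R]) c%:E)%E).
  rewrite integral_cst//= lebesgue_measure_itv /= lte_fin ifT; last by lra.
  by rewrite -EFinB -EFinM lte_fin mulr_gt0//; lra.
apply: (@le_trans _ _ (\int[mu]_(t in `[1%R, 2%R]) (integrand (a - 1) t)%:E)%E).
  apply: ge0_le_integral => //.
  - by move=> x _; rewrite lee_fin ltW.
  - by apply/measurable_EFinP; exact: measurable_integrand.
  - move=> t; rewrite /= in_itv /= => /andP[t1 t2]; rewrite lee_fin /integrand /c.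
    have t0 : 0 < t by lra.
    apply: ler_pM; rewrite ?expR_ge0 ?ler_expR//; last by lra.
    rewrite ge_min; have [a1|a1] := leP 0 (a - 1); apply/orP; [left|right].
      apply: (@le_trans _ _ (1 `^ (a - 1))); first by rewrite powR1.
      by apply: ge0_ler_powR => //; rewrite nnegrE; lra.
    rewrite -[a - 1]opprK 2!(powRN _ (- (a - 1))) lef_pV2 ?posrE ?powR_gt0//.
    by apply: ge0_ler_powR; rewrite ?nnegrE; lra.
apply: ge0_subset_integral => //.
- by apply/measurable_EFinP; exact: measurable_integrand.
- by move=> x _; rewrite lee_fin integrand_ge0.
- by move=> x; rewrite /= !in_itv /= andbT => /andP[x1 _]; lra.
Qed.

End Gamma.

(** * Duality *)

Section dual1.
Context {R : realType} (m : R) (hm : 0 < m).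
Implicit Types k n : nat.

Let c k : R := Gamma (m / 2) / Gamma (m / 2 + k%:R).

Let shape_gt0 k : 0 < m / 2 + k%:R.
Proof. by rewrite ltr_wpDr ?ler0n// divr_gt0. Qed.

Let cS k : (m / 2 + k%:R) * c k.+1 = c k.
Proof.
rewrite /c -[k.+1%:R]natr1 addrA GammaS//; field.
by rewrite !gt_eqF ?Gamma_gt0// ltr_wpDr ?mulr_ge0.
Qed.

Lemma dual1E k n : dual1 m k n = (n ^_ k)%:R * c k.
Proof.
rewrite /dual1; case: leqP => kn; last by rewrite ffact_small// mul0r.
congr (_ * _); rewrite -(ffact_fact kn) natrM mulfK// pnatr_eq0 -lt0n fact_gt0.
Qed.

Let ffactS_real n k : (n ^_ k.+1)%:R = (n%:R - k%:R) * (n ^_ k)%:R :> R.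
Proof.
rewrite ffactnSr; have [kn|kn] := leqP k n; first by rewrite natrM natrB// mulrC.
by rewrite ffact_small// mul0n mulr0.
Qed.

(** Together with [dual1S] and [dual1_succ], an intertwining relation of su(1,1) type: lowering and
    raising [n], as the jump rates do, becomes raising and lowering the degree [k]. At [n = 0] the
    truncated [n - 1] is harmless, since both sides vanish. *)
Lemma dual1_pred k n :
  n%:R * dual1 m k (n - 1) = (n%:R - k%:R) * dual1 m k n.
Proof.
rewrite !dual1E !mulrA -ffactS_real; congr (_ * _).
by rewrite -natrM ffactnS subn1.
Qed.

Lemma dual1S k n :
  (m / 2 + k%:R) * dual1 m (k + 1) n = (n%:R - k%:R) * dual1 m k n.
Proof. by rewrite addn1 !dual1E mulrCA cS ffactS_real -mulrA. Qed.

Lemma dual1_succ k n : (m / 2 + n%:R) * dual1 m k (n + 1) =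
  (m / 2 + n%:R + k%:R) * dual1 m k n + k%:R * dual1 m (k - 1) n.
Proof.
rewrite !dual1E addn1; case: k => [|k]; first by rewrite !ffactn0; ring.
rewrite subn1 /= ffactSS -(cS k) natrM ffactS_real -[k.+1%:R]natr1 -[n.+1%:R]natr1; ring.
Qed.

Lemma dual1_ge0 k n : 0 <= dual1 m k n.
Proof. by rewrite dual1E mulr_ge0// divr_ge0// ltW// Gamma_gt0// divr_gt0. Qed.

Lemma dual10 n : dual1 m 0 n = 1.
Proof. by rewrite dual1E ffactn0 mul1r /c addr0 divff// gt_eqF// Gamma_gt0// divr_gt0. Qed.

Lemma dual11 n : dual1 m 1 n = 2 / m * n%:R.
Proof.
have := dual1S 0 n; rewrite dual10 !addr0 subr0 mulr1 add0n => <-.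
by rewrite mulrA [X in X * _](_ : _ = 1) ?mul1r//; field; rewrite gt_eqF.
Qed.

Lemma dual1_le k n : dual1 m k n <= c k * n%:R ^+ k.
Proof.
rewrite dual1E mulrC ler_wpM2l//.
  by apply: ltW; rewrite /c divr_gt0 ?Gamma_gt0 ?divr_gt0.
elim: k => [|k ih]; first by rewrite ffactn0 expr0.
by rewrite ffactnSr natrM exprSr ler_pM// ler_nat leq_subr.
Qed.

End dual1.

(* Otherwise conversion unfolds the integrals in [Gamma]. *)
#[local] Opaque dual1.

(** * Elementary moves on configurations *)

Section conf.
Context {N : nat}.
Implicit Types (x y z : site N) (eta : conf N) (b : 'I_N).

Definition lsite b : site N := widen_ord (leqnSn N) b.
Definition rsite b : site N := lift ord0 b.

Lemma lsite_neq_rsite b : lsite b != rsite b.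
Proof. by rewrite -val_eqE /= neq_ltn leqnn. Qed.

Lemma deltaE x z : delta x z = (x == z) :> nat.
Proof. by rewrite ffunE. Qed.

Lemma add_at_same x eta : add_at x eta x = (eta x + 1)%N.
Proof. by rewrite ffunE deltaE eqxx. Qed.

Lemma remove_at_same x eta : remove_at x eta x = (eta x - 1)%N.
Proof. by rewrite ffunE deltaE eqxx. Qed.

Lemma add_at_neq x z eta : z != x -> add_at x eta z = eta z.
Proof. by rewrite ffunE deltaE eq_sym => /negbTE ->; rewrite addn0. Qed.

Lemma remove_at_neq x z eta : z != x -> remove_at x eta z = eta z.
Proof. by rewrite ffunE deltaE eq_sym => /negbTE ->; rewrite subn0. Qed.

Lemma move_src x y eta : x != y -> move x y eta x = (eta x - 1)%N.
Proof. by move=> xy; rewrite add_at_neq// remove_at_same. Qed.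

Lemma move_dst x y eta : x != y -> move x y eta y = (eta y + 1)%N.
Proof. by move=> xy; rewrite add_at_same remove_at_neq// eq_sym. Qed.

Lemma move_neq x y z eta : z != x -> z != y -> move x y eta z = eta z.
Proof. by move=> zx zy; rewrite add_at_neq// remove_at_neq. Qed.

Lemma remove_atK x eta : (0 < eta x)%N -> add_at x (remove_at x eta) = eta.
Proof.
move=> h; apply/ffunP => z; have [->|zx] := eqVneq z x.
  by rewrite add_at_same remove_at_same subnK.
by rewrite add_at_neq// remove_at_neq.
Qed.

End conf.

Section duality.
Context {R : realType} {N : nat} (m : R) (hm : 0 < m).
Implicit Types (x y z : site N) (xi eta : conf N) (b : 'I_N).

(** Over the common denominator [1 - lam], death contributes [- k d] and birth [lam (k d + k ds)]:
    the factor [n] cancels in each of them. [K] stands for the product over the other sites. *)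
Let boundary_identity (h lam n k d dm dp ds K : R) : 1 - lam != 0 ->
  n * dm = (n - k) * d -> (h + n) * dp = (h + n + k) * d + k * ds ->
  n / (1 - lam) * (dm * K - d * K) + (h + n) * (lam / (1 - lam)) * (dp * K - d * K) =
  k * (lam / (1 - lam) * (ds * K) - d * K).
Proof.
move=> l0 e1 e2.
transitivity ((n * dm - n * d + lam * ((h + n) * dp - (h + n) * d)) * (K / (1 - lam))).
  by field.
by rewrite e1 e2; field.
Qed.

Lemma gen_boundary_dual lam x xi eta : lam < 1 ->
  gen_boundary m lam x (dual m xi) eta =
  (xi x)%:R * (lam / (1 - lam) * dual m (remove_at x xi) eta - dual m xi eta).
Proof.
move=> lam1; have l0 : 1 - lam != 0 by rewrite subr_eq0 gt_eqF.
pose K := \prod_(z < N.+1 | z != x) dual1 m (xi z) (eta z).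
have H xi' eta' : (forall z, z != x -> xi' z = xi z) ->
    (forall z, z != x -> eta' z = eta z) ->
    dual m xi' eta' = dual1 m (xi' x) (eta' x) * K.
  move=> h1 h2; rewrite /dual (bigD1 x isT) /K.
  by under eq_bigr => z zx do rewrite (h1 z zx) (h2 z zx).
have ra (e : conf N) z : z != x -> remove_at x e z = e z by exact: remove_at_neq.
have aa (e : conf N) z : z != x -> add_at x e z = e z by exact: add_at_neq.
rewrite /gen_boundary /death_rate /birth_rate !H//; try first [exact: ra | exact: aa].
rewrite !remove_at_same add_at_same.
have e1 := dual1_pred m (xi x) (eta x); have e2 := dual1_succ hm (xi x) (eta x).
exact: boundary_identity.
Qed.

(** Self-duality on one bond. [p], [q] are the occupations of eta and [a], [c] those of xi; the
    suffixes [m], [P] change eta by -1, +1, and [d], [u] change xi by -1, +1. Both sides reduce to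
    the same polynomial in the undisplaced and lowered values. *)
Let bulk_identity (p q a c x y K xm ym xP yP xd yd xu yu : R) :
  p * xm = (p - a) * x -> q * ym = (q - c) * y ->
  (m / 2 + p) * xP = (m / 2 + p + a) * x + a * xd ->
  (m / 2 + q) * yP = (m / 2 + q + c) * y + c * yd ->
  (m / 2 + a) * xu = (p - a) * x -> (m / 2 + c) * yu = (q - c) * y ->
  2 * p * (m + 2 * q) * (xm * (yP * K) - x * (y * K)) +
  2 * q * (m + 2 * p) * (xP * (ym * K) - x * (y * K)) =
  2 * a * (m + 2 * c) * (xd * (yu * K) - x * (y * K)) +
  2 * c * (m + 2 * a) * (xu * (yd * K) - x * (y * K)).
Proof.
(* In terms of m / 2 a rate [2 p (m + 2 q)] is [4 p (m / 2 + q)], a product of one lowering and one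
   raising factor. *)
have -> : m = 2 * (m / 2) by field.
have -> : 2 * (m / 2) / 2 = m / 2 by field.
set h := m / 2; move=> p1 p2 s1 s2 t1 t2.
transitivity (4 * K * ((p * xm) * ((h + q) * yP) - p * (h + q) * x * y +
  (q * ym) * ((h + p) * xP) - q * (h + p) * x * y)); first by ring.
transitivity (4 * K * ((a * xd) * ((h + c) * yu) - a * (h + c) * x * y +
  (c * yd) * ((h + a) * xu) - c * (h + a) * x * y)); last by ring.
rewrite p1 p2 s1 s2 t1 t2; ring.
Qed.

Lemma gen_bulk_dual xi eta :
  gen_bulk m (dual m xi) eta = gen_bulk m (fun xi' => dual m xi' eta) xi.
Proof.
rewrite /gen_bulk; apply: eq_bigr => b _ /=.
rewrite -/(lsite b) -/(rsite b).
have := lsite_neq_rsite b; move: (lsite b) (rsite b) => l r lr.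
have rl : r != l by rewrite eq_sym.
pose K := \prod_(z < N.+1 | (z != l) && (z != r)) dual1 m (xi z) (eta z).
have H xi' eta' : (forall z, z != l -> z != r -> xi' z = xi z) ->
    (forall z, z != l -> z != r -> eta' z = eta z) ->
    dual m xi' eta' = dual1 m (xi' l) (eta' l) * (dual1 m (xi' r) (eta' r) * K).
  move=> h1 h2; rewrite /dual (bigD1 l isT) (bigD1 r rl) /K.
  by under eq_bigr => z /andP[zl zr] do rewrite (h1 z zl zr) (h2 z zl zr).
have mlr (e : conf N) (z : site N) : z != l -> z != r -> move l r e z = e z by exact: move_neq.
have mrl (e : conf N) (z : site N) : z != l -> z != r -> move r l e z = e z.
  by move=> zl zr; exact: move_neq.
have tt (e : conf N) (z : site N) : z != l -> z != r -> e z = e z by [].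
rewrite (H _ _ (tt xi) (tt eta)) (H _ _ (tt xi) (mlr eta)) (H _ _ (tt xi) (mrl eta)).
rewrite (H _ _ (mlr xi) (tt eta)) (H _ _ (mrl xi) (tt eta)).
rewrite !(move_src _ lr) !(move_dst _ lr) !(move_src _ rl) !(move_dst _ rl).
have p1 := dual1_pred m (xi l) (eta l); have p2 := dual1_pred m (xi r) (eta r).
have s1 := dual1_succ hm (xi l) (eta l); have s2 := dual1_succ hm (xi r) (eta r).
have t1 := dual1S hm (xi l) (eta l); have t2 := dual1S hm (xi r) (eta r).
exact: (bulk_identity K p1 p2 s1 s2 t1 t2).
Qed.

End duality.

(** * The generator on linear functions *)

Section tot.
Context {N : nat}.
Implicit Types (x y : site N) (eta : conf N).

Definition tot eta : nat := (\sum_(x < N.+1) eta x)%N.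

Lemma tot_add_at x eta : tot (add_at x eta) = (tot eta).+1.
Proof.
rewrite /tot (bigD1 x)//= [in RHS](bigD1 x)//= add_at_same addn1 addSn.
by congr (_ + _).+1; apply: eq_bigr => z zx; rewrite add_at_neq.
Qed.

Lemma tot_remove_at x eta : (0 < eta x)%N -> tot eta = (tot (remove_at x eta)).+1.
Proof. by move=> h; rewrite -(tot_add_at x) remove_atK. Qed.

Lemma tot_move x y eta : (0 < eta x)%N -> tot (move x y eta) = tot eta.
Proof. by move=> h; rewrite tot_add_at (tot_remove_at h). Qed.

Lemma leq_tot x eta : (eta x <= tot eta)%N.
Proof. by rewrite /tot (bigD1 x)//= leq_addr. Qed.

Lemma finite_tot_le n : finite_set [set eta : conf N | (tot eta <= n)%N].
Proof.
apply: (@sub_finite_set _ _ ((fun f : {ffun 'I_N.+1 -> 'I_n.+1} =>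
  ([ffun x => nat_of_ord (f x)] : conf N)) @` setT)); last exact: finite_image.
move=> eta /= h; exists [ffun x => inord (eta x)] => //.
apply/ffunP => x; rewrite !ffunE inordK// ltnS.
by apply: leq_trans h; exact: leq_tot.
Qed.

End tot.

(** * Comparison principle for the generator *)

Section comparison.
Context {R : realType} {N : nat} (m : R) (hm : 0 < m).
Implicit Types (x y : site N) (f g : conf N -> R) (eta : conf N).

(** At a contact point only the values after a jump differ, and they enter with nonnegative
    rates. *)
Lemma gen_boundary_le lam x f g eta : 0 <= lam < 1 ->
  (forall zeta, f zeta <= g zeta) -> f eta = g eta ->
  gen_boundary m lam x f eta <= gen_boundary m lam x g eta.
Proof.
move=> /andP[l0 l1] fg e; rewrite /gen_boundary e.
have l10 : 0 < 1 - lam by rewrite subr_gt0.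
have dr : 0 <= death_rate lam (eta x) by rewrite divr_ge0// ltW.
have br : 0 <= birth_rate m lam (eta x).
  by rewrite mulr_ge0 ?divr_ge0 ?(ltW l10)// addr_ge0// divr_ge0// ltW.
by apply: lerD; apply: ler_wpM2l; rewrite ?lerD2r.
Qed.

(** Bulk jumps preserve the number of particles, so the comparison is needed at that number only;
    the minimum principle at fixed particle number relies on this. *)
Lemma gen_bulk_le f g eta :
  (forall zeta, tot zeta = tot eta -> f zeta <= g zeta) -> f eta = g eta ->
  gen_bulk m f eta <= gen_bulk m g eta.
Proof.
move=> fg e; rewrite /gen_bulk; apply: ler_sum => b _ /=; rewrite e.
have H (x y : site N) : 2 * (eta x)%:R * (m + 2 * (eta y)%:R) * (f (move x y eta) - g eta) <=
    2 * (eta x)%:R * (m + 2 * (eta y)%:R) * (g (move x y eta) - g eta).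
  (* From an empty source, truncated subtraction makes [move] create a particle; the rate 0 disposes
     of this case. *)
  have [->|h] := posnP (eta x); first by rewrite !(mulr0, mul0r).
  apply: ler_wpM2l; last by rewrite lerD2r fg// tot_move.
  by rewrite !mulr_ge0// addr_ge0 ?mulr_ge0// ltW.
exact: lerD.
Qed.

Lemma gen_le lamL lamR f g eta : 0 <= lamL < 1 -> 0 <= lamR < 1 ->
  (forall zeta, f zeta <= g zeta) -> f eta = g eta ->
  gen m lamL lamR f eta <= gen m lamL lamR g eta.
Proof.
by move=> hL hR fg e; apply: lerD; [apply: lerD|]; [exact: gen_boundary_le..|apply: gen_bulk_le].
Qed.

End comparison.

Section linearity.
Context {R : realType} {N : nat} (m : R).
Implicit Types (x y : site N) (f g : conf N -> R) (eta : conf N).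

Lemma gen_boundary_lin lam x f g (c : R) eta :
  gen_boundary m lam x (fun z => f z + c * g z) eta =
  gen_boundary m lam x f eta + c * gen_boundary m lam x g eta.
Proof. rewrite /gen_boundary; ring. Qed.

Lemma gen_bulk_lin f g (c : R) eta :
  gen_bulk m (fun z => f z + c * g z) eta = gen_bulk m f eta + c * gen_bulk m g eta.
Proof.
rewrite /gen_bulk mulr_sumr -big_split; apply: eq_bigr => b _ /=.
move: (widen_ord _ _) (lift _ _) => l r; ring.
Qed.

Lemma gen_lin lamL lamR f g (c : R) eta :
  gen m lamL lamR (fun z => f z + c * g z) eta =
  gen m lamL lamR f eta + c * gen m lamL lamR g eta.
Proof. rewrite /gen !gen_boundary_lin gen_bulk_lin; ring. Qed.

Lemma gen_cst lamL lamR (c : R) eta : gen m lamL lamR (fun=> c) eta = 0.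
Proof.
rewrite /gen /gen_boundary !subrr !mulr0 !add0r /gen_bulk.
by apply: big1 => b _ /=; rewrite subrr !mulr0 addr0.
Qed.

End linearity.

Section linear_function.
Context {R : realType} {N : nat}.
Implicit Types (x y : site N) (w : site N -> R) (eta : conf N).

Definition lin w eta : R := \sum_(x < N.+1) w x * (eta x)%:R.

Lemma lin_add_at w x eta : lin w (add_at x eta) = lin w eta + w x.
Proof.
rewrite /lin (bigD1 x)//= [in RHS](bigD1 x)//= add_at_same natrD.
under eq_bigr => z zx do rewrite add_at_neq//.
ring.
Qed.

Lemma lin_remove_at w x eta : (0 < eta x)%N -> lin w (remove_at x eta) = lin w eta - w x.
Proof. by move=> h; rewrite -{2}(remove_atK h) lin_add_at addrK. Qed.

Lemma lin_move w x y eta : (0 < eta x)%N ->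
  lin w (move x y eta) = lin w eta + (w y - w x).
Proof. by move=> h; rewrite lin_add_at lin_remove_at// addrAC addrA. Qed.

Lemma lin_ge c w eta : (forall x, c <= w x) -> c * (tot eta)%:R <= lin w eta.
Proof.
by move=> h; rewrite /tot natr_sum mulr_sumr; apply: ler_sum => x _; exact: ler_wpM2r.
Qed.

Lemma lin_le c w eta : (forall x, w x <= c) -> lin w eta <= c * (tot eta)%:R.
Proof.
by move=> h; rewrite /tot natr_sum mulr_sumr; apply: ler_sum => x _; exact: ler_wpM2r.
Qed.

(** The quadratic parts of the two opposite rates on a bond cancel, which leaves independent walkers
    of rate [2 m]. *)
Lemma gen_bulk_linear m w eta : gen_bulk m (lin w) eta =
  \sum_(b < N) 2 * m * ((eta (lsite b))%:R - (eta (rsite b))%:R) * (w (rsite b) - w (lsite b)).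
Proof.
rewrite /gen_bulk; apply: eq_bigr => b _ /=.
rewrite -/(lsite b) -/(rsite b); move: (lsite b) (rsite b) => l r.
have H x y : (eta x)%:R * (lin w (move x y eta) - lin w eta) = (eta x)%:R * (w y - w x).
  have [->|h] := posnP (eta x); first by rewrite !mul0r.
  by rewrite lin_move// addrC addKr.
transitivity (2 * (m + 2 * (eta r)%:R) * ((eta l)%:R * (lin w (move l r eta) - lin w eta)) +
  2 * (m + 2 * (eta l)%:R) * ((eta r)%:R * (lin w (move r l eta) - lin w eta))).
  by ring.
by rewrite !H; ring.
Qed.

Lemma gen_bulk_tot m (f : conf N -> R) (g : nat -> R) eta :
  gen_bulk m (fun e => f e * g (tot e)) eta = g (tot eta) * gen_bulk m f eta.
Proof.
rewrite /gen_bulk mulr_sumr; apply: eq_bigr => b _ /=.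
move: (widen_ord _ _) (lift _ _) => l r.
have H x y : (eta x)%:R * (f (move x y eta) * g (tot (move x y eta)) - f eta * g (tot eta))
   = (eta x)%:R * (g (tot eta) * (f (move x y eta) - f eta)).
  have [->|h] := posnP (eta x); first by rewrite !mul0r.
  by rewrite tot_move//; ring.
transitivity (2 * (m + 2 * (eta r)%:R) *
    ((eta l)%:R * (f (move l r eta) * g (tot (move l r eta)) - f eta * g (tot eta))) +
  2 * (m + 2 * (eta l)%:R) *
    ((eta r)%:R * (f (move r l eta) * g (tot (move r l eta)) - f eta * g (tot eta)))).
  by ring.
by rewrite !H; ring.
Qed.

End linear_function.

Section weight.
Context {R : realType} {N : nat} (m : R) (hm : 0 < m).
Implicit Types (x y : site N) (eta : conf N).

(** The parabola x (N - x) has second difference -2, which at walker rate [2 m] produces the drift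
    [- 4 m] per particle. The constant is the coefficient of the end terms left by summation by
    parts in [gen_bulk_weight], so that removal at the ends, of net rate 1 per particle, cancels
    them. *)
Definition weight_end : R := 2 * m * N.+1%:R.

Definition weight x : R := weight_end + (x * (N - x))%:R.

Lemma weight_ord0 : weight ord0 = weight_end.
Proof. by rewrite /weight mul0n addr0. Qed.

Lemma weight_ord_max : weight ord_max = weight_end.
Proof. by rewrite /weight /= subnn muln0 addr0. Qed.

Lemma weight_end_gt0 : 0 < weight_end.
Proof. by rewrite !mulr_gt0. Qed.

Lemma weight_ge x : weight_end <= weight x.
Proof. by rewrite lerDl. Qed.

Lemma weight_le x : weight x <= weight_end + (N * N)%:R.
Proof. by rewrite lerD2l ler_nat leq_mul ?leq_subr// -ltnS. Qed.

Lemma gen_bulk_weight eta : gen_bulk m (lin weight) eta =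
  weight_end * ((eta ord0)%:R + (eta ord_max)%:R) - 4 * m * (tot eta)%:R.
Proof.
rewrite gen_bulk_linear.
(* The parabola has increment N - 2b - 1 on bond b. Against it, a difference of occupations becomes
   a telescoping difference of [F] minus the two occupations. *)
pose F (i : site N) : R := (eta i)%:R * (N%:R - 2 * i%:R).
have E b : 2 * m * ((eta (lsite b))%:R - (eta (rsite b))%:R) *
    (weight (rsite b) - weight (lsite b)) =
    2 * m * (F (lsite b) - F (rsite b) - (eta (lsite b))%:R - (eta (rsite b))%:R).
  have bN : (b < N)%N by [].
  have -> : weight (rsite b) - weight (lsite b) = N%:R - 2 * b%:R - 1.
    rewrite /weight /= /bump /= add1n !natrM !natrB// ?(ltnW bN)// -natr1; ring.
  rewrite /F /= /bump /= add1n -[b.+1%:R]natr1; ring.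
under eq_bigr do rewrite E.
rewrite -mulr_sumr !sumrB.
have Fl : \sum_(b < N) F (lsite b) = \sum_(i < N.+1) F i - F ord_max.
  by rewrite [in RHS]big_ord_recr /= addrK.
have Fr : \sum_(b < N) F (rsite b) = \sum_(i < N.+1) F i - F ord0.
  by rewrite [in RHS]big_ord_recl /= addrC addKr.
have Vl : \sum_(b < N) (eta (lsite b))%:R = (tot eta)%:R - (eta ord_max)%:R :> R.
  by rewrite /tot natr_sum [in RHS]big_ord_recr /= addrK.
have Vr : \sum_(b < N) (eta (rsite b))%:R = (tot eta)%:R - (eta ord0)%:R :> R.
  by rewrite /tot natr_sum [in RHS]big_ord_recl /= addrC addKr.
rewrite Fl Fr Vl Vr /F /weight_end /= -[N.+1%:R]natr1; ring.
Qed.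

End weight.

Arguments weight_end {R} N m.

(** * Lyapunov functions *)

Section power_differences.
Context {R : realType}.
Implicit Types (v : R) (k : nat).

(** This and the next two bounds express that each difference of a power lowers its order by one;
    multiplying through by [v] avoids the exponents k - 1 and k - 2. *)
Lemma forward_difference_expr v k : 0 <= v ->
  v * ((v + 1) ^+ k - v ^+ k) <= k%:R * (v + 1) ^+ k.
Proof.
move=> v0; elim: k => [|k ih]; first by rewrite !expr0 subrr mulr0 mul0r.
have p0 : 0 <= (v + 1) ^+ k by rewrite exprn_ge0// addr_ge0.
rewrite !exprS -[k.+1%:R]natr1.
set p := (v + 1) ^+ k in ih p0 *; set z := v ^+ k in ih *.
have -> : v * ((v + 1) * p - v * z) = v * (v * (p - z)) + v * p by ring.
have h := ler_wpM2l v0 ih.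
have kp : 0 <= k%:R * p by rewrite mulr_ge0.
nra.
Qed.

Lemma central_difference_expr v k : 1 <= v ->
  0 <= (v + 1) ^+ k - (v - 1) ^+ k /\
  v * ((v + 1) ^+ k - (v - 1) ^+ k) <= (2 * k)%:R * (v + 1) ^+ k.
Proof.
move=> v1; elim: k => [|k [ih0 ih]]; first by rewrite !expr0 subrr muln0 mulr0 mul0r.
have v0 : 0 <= v by lra.
have p0 : 0 <= (v + 1) ^+ k by rewrite exprn_ge0//; lra.
have q0 : 0 <= (v - 1) ^+ k by rewrite exprn_ge0//; lra.
rewrite !exprS (_ : (2 * k.+1)%:R = (2 * k)%:R + 2 :> R); last by rewrite mulnS addnC natrD.
set p := (v + 1) ^+ k in ih ih0 p0 *; set q := (v - 1) ^+ k in ih ih0 q0 *.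
have E : (v + 1) * p - (v - 1) * q = v * (p - q) + (p + q) by ring.
rewrite E; split; first by rewrite addr_ge0 ?mulr_ge0// addr_ge0.
have h := ler_wpM2l v0 ih.
have kp : 0 <= (2 * k)%:R * p by rewrite mulr_ge0.
nra.
Qed.

(** The second difference for k + 1 is [v] times the one for k plus a central difference, so the
    constant grows from k^2 to at most k^2 + 2k. *)
Lemma second_difference_expr v k : 1 <= v ->
  0 <= (v + 1) ^+ k + (v - 1) ^+ k - 2 * v ^+ k /\
  v ^+ 2 * ((v + 1) ^+ k + (v - 1) ^+ k - 2 * v ^+ k) <= (k * k)%:R * (v + 1) ^+ k.
Proof.
move=> v1; elim: k => [|k [ih0 ih]].
  rewrite !expr0 (_ : 1 + 1 - 2 * 1 = 0 :> R) ?mulr0; last by ring.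
  by rewrite mul0n mul0r.
have [d0 d] := central_difference_expr k v1.
have v0 : 0 <= v by lra.
have p0 : 0 <= (v + 1) ^+ k by rewrite exprn_ge0//; lra.
rewrite !(exprS _ k) (_ : (k.+1 * k.+1)%:R = (k * k)%:R + (2 * k)%:R + 1 :> R); last first.
  by rewrite mulSn mulnS -!natrD natr1; congr _%:R; rewrite mul2n -addnn; lia.
move: ih0 ih d0 d p0; set p := (v + 1) ^+ k; set q := (v - 1) ^+ k.
set z := v ^+ k => ih0 ih d0 d p0.
have E : (v + 1) * p + (v - 1) * q - 2 * (v * z) = v * (p + q - 2 * z) + (p - q) by ring.
rewrite E; split; first by rewrite addr_ge0 ?mulr_ge0.
have h := ler_wpM2l v0 ih.
have h2 := ler_wpM2l v0 d.
have kp : 0 <= (2 * k)%:R * p by rewrite mulr_ge0.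
have kp2 : 0 <= (k * k)%:R * p by rewrite mulr_ge0.
have -> : v ^+ 2 * (v * (p + q - 2 * z) + (p - q)) =
  v * (v ^+ 2 * (p + q - 2 * z)) + v * (v * (p - q)) by ring.
nra.
Qed.

End power_differences.

Section lyapunov.
Context {R : realType} {N : nat} (m : R) (hm : 0 < m).
Implicit Types (x : site N) (eta : conf N).

Definition lyapunov k eta : R := lin (weight m) eta * (tot eta)%:R ^+ k.

Lemma lyapunov_ge k eta : weight_end N m * (tot eta)%:R ^+ k.+1 <= lyapunov k eta.
Proof.
rewrite exprS mulrA ler_wpM2r ?exprn_ge0//.
by apply: lin_ge => x; exact: weight_ge.
Qed.

(** With n particles at [x], the death rate n / (1 - lam) is n + rho n. Its part n gives the
    negative term. Its part rho n pairs with the part rho n of the birth rate into a second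
    difference, and the rest rho m / 2 of the birth rate multiplies a forward difference; both are
    of order V^k. *)
Lemma gen_boundary_lyapunov lam x k : 0 <= lam < 1 -> weight m x = weight_end N m ->
  exists2 A : R, 0 <= A & forall eta, gen_boundary m lam x (lyapunov k) eta <=
    A * ((tot eta)%:R + 1) ^+ k - weight_end N m * (eta x)%:R * (tot eta)%:R ^+ k.
Proof.
move=> /andP[l0 l1] wx.
set M := weight_end N m; pose q : R := M + (N * N)%:R.
have M0 : 0 < M by exact: weight_end_gt0.
have q0 : 0 <= q by rewrite addr_ge0// ltW.
have l10 : 0 < 1 - lam by rewrite subr_gt0.
pose rho := lam / (1 - lam).
have rho0 : 0 <= rho by rewrite divr_ge0// ltW.
(* In units of (V + 1)^k, [A3] bounds a forward difference of the Lyapunov function and [A2] bounds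
   n times its second difference; [q] bounds the weight. *)
pose A3 : R := q * k%:R + M.
pose A2 : R := q * (k * k)%:R + M * (2 * k)%:R.
have A30 : 0 <= A3 by rewrite addr_ge0 ?mulr_ge0// ltW.
have A20 : 0 <= A2 by rewrite addr_ge0 ?mulr_ge0// ltW.
have hm0 := ltW hm; have hm2 : 0 <= m / 2 by rewrite divr_ge0.
exists (rho * A2 + rho * (m / 2) * A3).
  by apply: addr_ge0; apply: mulr_ge0 => //; exact: mulr_ge0.
move=> eta.
rewrite /gen_boundary /death_rate /birth_rate -/rho.
have -> : (eta x)%:R / (1 - lam) = (eta x)%:R + rho * (eta x)%:R.
  by rewrite /rho; field; rewrite subr_eq0 gt_eqF.
set L := lyapunov k; set n : R := (eta x)%:R; set v : R := (tot eta)%:R.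
set Q := lin (weight m) eta.
have v0 : 0 <= v by [].
have Qv : Q <= q * v by apply: lin_le => z; exact: weight_le.
have Q0 : 0 <= Q by apply: sumr_ge0 => z _; rewrite mulr_ge0// (le_trans (ltW M0))// weight_ge.
have p0 : 0 <= (v + 1) ^+ k by rewrite exprn_ge0// addr_ge0.
have Lp : L (add_at x eta) = (Q + M) * (v + 1) ^+ k.
  by rewrite /L /lyapunov lin_add_at wx tot_add_at -natr1.
have L0 : L eta = Q * v ^+ k by [].
have h3 : L (add_at x eta) - L eta <= A3 * (v + 1) ^+ k.
  have f := forward_difference_expr k v0.
  have f0 : 0 <= (v + 1) ^+ k - v ^+ k by rewrite subr_ge0 lerXn2r ?nnegrE ?addr_ge0// lerDl.
  rewrite Lp L0 /A3.
  have -> : (Q + M) * (v + 1) ^+ k - Q * v ^+ k =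
    Q * ((v + 1) ^+ k - v ^+ k) + M * (v + 1) ^+ k by ring.
  rewrite [leRHS]mulrDl lerD2r.
  apply: (le_trans (ler_wpM2r f0 Qv)).
  by rewrite -2!mulrA ler_wpM2l.
have h3' := ler_wpM2l (mulr_ge0 rho0 hm2) h3.
(* On an empty site only births at rate rho m / 2 remain. Otherwise V >= 1, as the central and
   second differences require. *)
have [e0|e0] := posnP (eta x).
  rewrite /n e0 !(mulr0, mul0r, addr0, add0r, subr0).
  have t : 0 <= rho * A2 * (v + 1) ^+ k by apply: mulr_ge0 => //; exact: mulr_ge0.
  rewrite mulrDl -/rho; lra.
have v1 : 1 <= v by rewrite ler1n (leq_trans e0)// leq_tot.
have nv : n <= v by rewrite ler_nat leq_tot.
have Lm : L (remove_at x eta) = (Q - M) * (v - 1) ^+ k.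
  by rewrite /L /lyapunov lin_remove_at// wx /v (tot_remove_at e0) -natr1 addrK.
have QM : 0 <= Q - M.
  rewrite (_ : M = weight m x) // -lin_remove_at//; apply: sumr_ge0 => z _.
  by rewrite mulr_ge0// (le_trans (ltW M0))// weight_ge.
have h1 : n * (L (remove_at x eta) - L eta) <= - (M * n * v ^+ k).
  have f : (v - 1) ^+ k <= v ^+ k by rewrite lerXn2r ?nnegrE ?subr_ge0// gerBl.
  have := ler_wpM2l (ler0n R (eta x)) (ler_wpM2l QM f).
  rewrite Lm L0 -/n; lra.
have h2 : n * (L (remove_at x eta) - L eta) + n * (L (add_at x eta) - L eta) <= A2 * (v + 1) ^+ k.
  have [d0 d] := central_difference_expr k v1.
  have [s0 s] := second_difference_expr k v1.
  rewrite Lm L0 Lp.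
  set p := (v + 1) ^+ k in d0 d s0 s *; set z := v ^+ k in s0 s *.
  set l := (v - 1) ^+ k in d0 d s0 s *.
  have -> : n * ((Q - M) * l - Q * z) + n * ((Q + M) * p - Q * z) =
    n * Q * (p + l - 2 * z) + M * (n * (p - l)) by ring.
  rewrite /A2 [leRHS]mulrDl; apply: lerD.
    have : n * Q <= v * (q * v) by apply: ler_pM.
    move=> /(ler_wpM2r s0) /le_trans; apply.
    have -> : v * (q * v) * (p + l - 2 * z) = q * (v ^+ 2 * (p + l - 2 * z)) by ring.
    by rewrite -mulrA ler_wpM2l.
  rewrite -mulrA ler_wpM2l ?(ltW M0)//.
  by apply: le_trans d; rewrite ler_wpM2r.
have h2' := ler_wpM2l rho0 h2.
lra.
Qed.

(** The negative terms from the two ends cancel the end terms of [gen_bulk_weight] times V^k, and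
    the drift [- 4 m V] of the bulk survives. *)
Lemma gen_lyapunov lamL lamR k : 0 <= lamL < 1 -> 0 <= lamR < 1 ->
  exists2 A : R, 0 <= A & forall eta, gen m lamL lamR (lyapunov k) eta <=
    A * ((tot eta)%:R + 1) ^+ k - 4 * m * (tot eta)%:R ^+ k.+1.
Proof.
move=> hL hR.
have [A1 A10 h1] := gen_boundary_lyapunov k hL (weight_ord0 m).
have [A2 A20 h2] := gen_boundary_lyapunov k hR (weight_ord_max m).
exists (A1 + A2); first exact: addr_ge0.
move=> eta; have {}h1 := h1 eta; have {}h2 := h2 eta.
rewrite /gen.
have -> : gen_bulk m (lyapunov k) eta =
   (tot eta)%:R ^+ k * gen_bulk m (lin (weight m)) eta.
  exact: (gen_bulk_tot m (lin (weight m)) (fun n => n%:R ^+ k)).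
rewrite gen_bulk_weight exprS.
lra.
Qed.

End lyapunov.

(** * Stationarity on finite sublevel sets *)

Section finite_support.
Context {R : realType} {N : nat}.
Implicit Types (s : seq (conf N)) (f : conf N -> R) (nu : probability (conf N) R).

Lemma measurable_conf (A : set (conf N)) : measurable A.
Proof. by []. Qed.

Lemma measurable_fun_conf d (T : measurableType d) (D : set (conf N)) (f : conf N -> T) :
  measurable_fun D f.
Proof. by move=> mD Y mY; exact: measurable_conf. Qed.

Lemma integrable_bounded nu (D : set (conf N)) f (B : R) :
  (forall eta, D eta -> `|f eta| <= B) -> nu.-integrable D (EFin \o f).
Proof.
move=> h; apply: measurable_bounded_integrable.
- exact: measurable_conf.
- exact: le_lt_trans (probability_le1 nu (measurable_conf D)) (ltry _).
- exact: measurable_fun_conf.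
- exists B; split=> [|M BM eta De]; first exact: num_real.
  by apply: (le_trans (h eta De)); exact: ltW.
Qed.

Lemma integrable_seq nu s f : nu.-integrable [set` s] (EFin \o f).
Proof.
apply: (@integrable_bounded _ _ _ (\sum_(z <- s) `|f z|)) => eta /= es.
by rewrite (big_rem eta)//= lerDl sumr_ge0.
Qed.

Lemma Rintegral_seq nu s f : uniq s ->
  \int[nu]_(eta in [set` s]) f eta = \sum_(z <- s) f z * fine (nu [set z]).
Proof.
elim: s => [_|z s ih /= /andP[zs us]].
  by rewrite big_nil (_ : [set` [::]] = set0) ?Rintegral_set0//; apply/seteqP; split.
have E : [set` z :: s] = [set z] `|` [set` s].
  apply/seteqP; split => e /=; first by rewrite in_cons => /orP[/eqP ->|]; [left|right].
  by rewrite in_cons => -[->|->]; rewrite ?eqxx// orbT.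
have := integrable_seq nu (z :: s) f; rewrite E => ii.
rewrite big_cons Rintegral_setU ?ih//; last first.
  by apply/disj_setPS => e [/= -> es]; rewrite es in zs.
congr (_ + _); rewrite -[RHS](Rintegral_cst nu (measurable_conf [set z])).
by apply: eq_Rintegral => e; rewrite inE /= => ->.
Qed.

Lemma Rintegral_supp nu s f : uniq s -> (forall z, z \notin s -> f z = 0) ->
  \int[nu]_eta f eta = \sum_(z <- s) f z * fine (nu [set z]).
Proof.
move=> us h; rewrite -Rintegral_seq// [RHS]Rintegral_mkcond.
apply: eq_Rintegral => z _; rewrite patchE.
by case: ifPn => //; rewrite notin_setE /= => /negP /h.
Qed.

Lemma fine_probability nu (A : set (conf N)) : (fine (nu A))%:E = nu A.
Proof. by rewrite fineK// fin_num_measure//; exact: measurable_conf. Qed.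

End finite_support.

Section drift.
Context {R : realType} {N : nat} (m lamL lamR : R).
Hypotheses (hm : 0 < m) (hL : 0 <= lamL < 1) (hR : 0 <= lamR < 1).
Context (P : R -> conf N -> probability (conf N) R).
Hypothesis hP : is_markov_semigroup (gen m lamL lamR) P.
Context (mu : probability (conf N) R).
Hypothesis hmu : stationary P mu.
Implicit Types (s : seq (conf N)) (f G : conf N -> R) (eta : conf N).

(** Restricting the stationarity integral at [[set z]] to a finite set only discards nonnegative
    mass. *)
Let stationary_point s t z : uniq s -> 0 <= t ->
  \sum_(eta <- s) fine (P t eta [set z]) * fine (mu [set eta]) <= fine (mu [set z]).
Proof.
move=> us t0; rewrite -Rintegral_seq//.
rewrite -lee_fin fine_probability -(hmu [set z] t0) /Rintegral fineK; last first.
  apply: integrable_fin_num; first exact: measurable_conf.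
  exact: (integrable_seq mu s (fun eta => fine (P t eta [set z]))).
under eq_integral do rewrite fine_probability.
exact: ge0_subset_integral.
Qed.

(** Over a finite set the limit t -> 0 may be taken term by term. Before the limit, exchanging the
    two sums and applying [stationary_point] gives the sign; it is an inequality because mass
    arriving from outside [s] is dropped. *)
Let stationary_gen_le0 s f : uniq s -> (forall z, 0 <= f z) ->
  (forall z, z \notin s -> f z = 0) ->
  \sum_(eta <- s) gen m lamL lamR f eta * fine (mu [set eta]) <= 0.
Proof.
move=> us f0 fs.
have fin : finite_set [set z | f z != 0].
  apply: (@sub_finite_set _ _ [set` s]); last exact: finite_seq.
  by move=> z /=; apply: contraNT => /fs ->.
have lim : \sum_(eta <- s) t^-1 * (\int[P t eta]_zeta f zeta - f eta) * fine (mu [set eta])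
   @[t --> 0^'+] --> \sum_(eta <- s) gen m lamL lamR f eta * fine (mu [set eta]).
  elim: (s) => [|z r ih].
    by rewrite big_nil; under eq_fun do rewrite big_nil; exact: cvg_cst.
  rewrite big_cons; under eq_fun do rewrite big_cons.
  apply: cvgD => //; apply: cvgMl; exact: (semigroup_gen hP).
apply: (cvgr_to_le lim); near=> t.
have t0 : 0 < t by near: t; exact: nbhs_right_gt.
under eq_bigr do rewrite -mulrA.
rewrite -mulr_sumr pmulr_rle0 ?invr_gt0//.
under eq_bigr do rewrite mulrBl.
rewrite sumrB subr_le0.
under eq_bigr do rewrite (Rintegral_supp _ us fs) mulr_suml.
rewrite exchange_big /=; apply: ler_sum => z _.
under eq_bigr do rewrite -mulrA.
rewrite -mulr_sumr ler_wpM2l//.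
exact/stationary_point/ltW.
Unshelve. all: by end_near. Qed.

(** The truncation max(K - G, 0) touches K - G on the sublevel set and dominates it everywhere, so
    by [gen_le] its generator there is at least that of K - G. *)
Lemma drift_ge0 G K : finite_set [set eta | G eta < K] ->
  0 <= \int[mu]_(eta in [set eta | G eta < K]) gen m lamL lamR G eta.
Proof.
move=> /finite_seqP[s0 Es0].
pose s := undup s0; have us : uniq s by exact: undup_uniq.
have sE z : (z \in s) = (G z < K).
  have : [set` s0] z = (G z < K) :> Prop by rewrite -Es0.
  rewrite /s mem_undup /= => h; apply/idP/idP; by rewrite h.
have Es : [set eta | G eta < K] = [set` s].
  by apply/seteqP; split => z /=; rewrite sE.
rewrite Es Rintegral_seq//.
pose f z := Num.max (K - G z) 0.
have f0 z : 0 <= f z by rewrite /f le_max lexx orbT.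
have fs z : z \notin s -> f z = 0.
  by rewrite sE -leNgt => h; apply/max_idPr; rewrite subr_le0.
have := stationary_gen_le0 us f0 fs.
rewrite -oppr_ge0 => /le_trans; apply.
rewrite -sumrN big_seq [leRHS]big_seq; apply: ler_sum => z; rewrite sE => zK.
rewrite -mulNr; apply: ler_wpM2r; first by rewrite fine_ge0.
rewrite lerNl.
have -> : - gen m lamL lamR G z = gen m lamL lamR (fun e => K + (-1) * G e) z.
  by rewrite gen_lin gen_cst add0r mulN1r.
apply: gen_le => // [e|]; first by rewrite mulN1r /f le_max lexx.
by rewrite mulN1r /f; apply/esym/max_idPl; rewrite subr_ge0 ltW.
Qed.

End drift.

(** * Moments *)

Section polynomially_bounded.
Context {R : realType} {N : nat}.
Implicit Types (f g : conf N -> R) (eta : conf N) (k : nat).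

Definition growth eta : R := (tot eta)%:R + 1.

Definition poly_bounded f := exists (k : nat) (C : R),
  0 <= C /\ forall eta, `|f eta| <= C * growth eta ^+ k.

Lemma growth_ge1 eta : 1 <= growth eta.
Proof. by rewrite lerDr. Qed.

Lemma growth_gt0 eta : 0 < growth eta.
Proof. exact: lt_le_trans ltr01 (growth_ge1 eta). Qed.

Lemma growth_exp_le eta k l : (k <= l)%N -> growth eta ^+ k <= growth eta ^+ l.
Proof. by move=> kl; rewrite ler_weXn2l// growth_ge1. Qed.

Lemma growth_exp_le_tot eta k : growth eta ^+ k <= 2 ^+ k * ((tot eta)%:R ^+ k + 1).
Proof.
rewrite /growth; have [->|h] := posnP (tot eta).
  rewrite add0r expr1n mulrDr mulr1 -[leLHS]add0r lerD ?mulr_ge0//.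
  by rewrite exprn_ege1// ler1n.
apply: (@le_trans _ _ ((2 * (tot eta)%:R) ^+ k)).
  apply: lerXn2r; rewrite ?nnegrE//.
  have : 1 <= (tot eta)%:R :> R by rewrite ler1n.
  lra.
by rewrite exprMn ler_wpM2l// lerDl.
Qed.

Lemma poly_bounded_cst (c : R) : poly_bounded (fun=> c).
Proof. by exists 0%N, `|c|; split => // eta; rewrite expr0 mulr1. Qed.

Lemma poly_boundedD f g :
  poly_bounded f -> poly_bounded g -> poly_bounded (fun eta => f eta + g eta).
Proof.
move=> [k [C [C0 hf]]] [l [D [D0 hg]]]; exists (maxn k l), (C + D).
split; first exact: addr_ge0.
move=> eta; rewrite mulrDl; apply: (le_trans (ler_normD _ _)); apply: lerD.
  by apply: (le_trans (hf eta)); rewrite ler_wpM2l// growth_exp_le// leq_maxl.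
by apply: (le_trans (hg eta)); rewrite ler_wpM2l// growth_exp_le// leq_maxr.
Qed.

Lemma poly_boundedM f g :
  poly_bounded f -> poly_bounded g -> poly_bounded (fun eta => f eta * g eta).
Proof.
move=> [k [C [C0 hf]]] [l [D [D0 hg]]]; exists (k + l)%N, (C * D).
split; first exact: mulr_ge0.
by move=> eta; rewrite normrM exprD mulrACA; apply: ler_pM.
Qed.

Lemma poly_boundedB f g :
  poly_bounded f -> poly_bounded g -> poly_bounded (fun eta => f eta - g eta).
Proof.
move=> hf hg; apply: poly_boundedD => //.
have [k [C [C0 h]]] := hg; exists k, C; split => // eta.
by rewrite normrN.
Qed.

Lemma poly_bounded_sum (I : Type) (r : seq I) (F : I -> conf N -> R) :
  (forall i, poly_bounded (F i)) -> poly_bounded (fun eta => \sum_(i <- r) F i eta).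
Proof.
move=> h; elim: r => [|i r ih].
  under eq_fun do rewrite big_nil; exact: poly_bounded_cst.
under eq_fun do rewrite big_cons; exact: poly_boundedD.
Qed.

Lemma poly_bounded_prod (I : Type) (r : seq I) (F : I -> conf N -> R) :
  (forall i, poly_bounded (F i)) -> poly_bounded (fun eta => \prod_(i <- r) F i eta).
Proof.
move=> h; elim: r => [|i r ih].
  under eq_fun do rewrite big_nil; exact: poly_bounded_cst.
under eq_fun do rewrite big_cons; exact: poly_boundedM.
Qed.

Lemma poly_boundedX f k : poly_bounded f -> poly_bounded (fun eta => f eta ^+ k).
Proof.
move=> hf; elim: k => [|k ih]; first exact: poly_bounded_cst.
under eq_fun do rewrite exprS; exact: poly_boundedM.
Qed.

Lemma poly_bounded_le f g :
  poly_bounded g -> (forall eta, `|f eta| <= `|g eta|) -> poly_bounded f.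
Proof.
move=> [k [C [C0 hg]]] fg; exists k, C; split => // eta.
exact: le_trans (fg eta) (hg eta).
Qed.

Lemma poly_bounded_tot : poly_bounded (fun eta => (tot eta)%:R).
Proof. by exists 1%N, 1; split => // eta; rewrite mul1r normr_nat lerDl. Qed.

Lemma poly_bounded_occ (x : site N) : poly_bounded (fun eta => (eta x)%:R).
Proof.
apply: poly_bounded_le poly_bounded_tot _ => eta.
by rewrite !normr_nat ler_nat leq_tot.
Qed.

(** One extra particle at most doubles [growth], whence the factor [2 ^+ k]. *)
Lemma poly_bounded_comp f (T : conf N -> conf N) :
  (forall eta, (tot (T eta) <= (tot eta).+1)%N) ->
  poly_bounded f -> poly_bounded (fun eta => f (T eta)).
Proof.
move=> hT [k [C [C0 hf]]]; exists k, (C * 2 ^+ k); split; first by rewrite mulr_ge0.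
move=> eta; apply: (le_trans (hf (T eta))).
rewrite -mulrA ler_wpM2l// -exprMn; apply: lerXn2r; rewrite ?nnegrE.
- by rewrite (le_trans ler01)// growth_ge1.
- by rewrite mulr_ge0// (le_trans ler01)// growth_ge1.
- have : (tot (T eta))%:R <= (tot eta).+1%:R :> R by rewrite ler_nat.
  have := growth_ge1 eta; rewrite /growth -natr1; lra.
Qed.

Let tot_remove_at_le x eta : (tot (remove_at x eta) <= tot eta)%N.
Proof. by apply: leq_sum => z _; rewrite ffunE leq_subr. Qed.

Lemma poly_bounded_gen (m lamL lamR : R) f :
  poly_bounded f -> poly_bounded (gen m lamL lamR f).
Proof.
move=> hf.
have B lam x : poly_bounded (gen_boundary m lam x f).
  apply: poly_boundedD; apply: poly_boundedM.
  - exact: poly_boundedM (poly_bounded_occ x) (poly_bounded_cst _).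
  - apply: poly_boundedB => //; apply: poly_bounded_comp => // eta.
    exact: leq_trans (tot_remove_at_le x eta) (leqnSn _).
  - apply: poly_boundedM; last exact: poly_bounded_cst.
    exact: poly_boundedD (poly_bounded_cst _) (poly_bounded_occ x).
  - apply: poly_boundedB => //; apply: poly_bounded_comp => // eta.
    by rewrite tot_add_at.
have M x y : poly_bounded (fun eta =>
    2 * (eta x)%:R * (m + 2 * (eta y)%:R) * (f (move x y eta) - f eta)).
  apply: poly_boundedM.
    apply: poly_boundedM.
      exact: poly_boundedM (poly_bounded_cst _) (poly_bounded_occ x).
    apply: poly_boundedD; first exact: poly_bounded_cst.
    exact: poly_boundedM (poly_bounded_cst _) (poly_bounded_occ y).
  apply: poly_boundedB => //; apply: poly_bounded_comp => // eta.
  by rewrite tot_add_at ltnS tot_remove_at_le.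
apply: poly_boundedD; first exact: poly_boundedD.
by apply: poly_bounded_sum => b; exact: poly_boundedD.
Qed.

Lemma poly_bounded_dual (m : R) (hm : 0 < m) xi : poly_bounded (dual m xi).
Proof.
apply: poly_bounded_prod => x.
have := dual1_le hm (xi x); set c := Gamma _ / _ => h.
apply: (@poly_bounded_le _ (fun eta => c * (eta x)%:R ^+ xi x)).
  apply: poly_boundedM; first exact: poly_bounded_cst.
  exact: poly_boundedX (poly_bounded_occ x).
move=> eta; rewrite ger0_norm ?dual1_ge0//.
exact: le_trans (h (eta x)) (ler_norm _).
Qed.

Lemma finite_sublevel f (B : R -> R) :
  (forall K eta, f eta < K -> (tot eta)%:R < B K) ->
  forall K, finite_set [set eta | f eta < K].
Proof.
move=> h K; apply: (sub_finite_set _ (finite_tot_le (Num.truncn (B K)))) => eta /= /h hB.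
by rewrite -ltnS -(ltr_nat R); apply: lt_trans hB (truncnS_gt _).
Qed.

End polynomially_bounded.

Section moments.
Context {R : realType} {N : nat} (m lamL lamR : R).
Hypotheses (hm : 0 < m) (hL : 0 <= lamL < 1) (hR : 0 <= lamR < 1).
Context (P : R -> conf N -> probability (conf N) R).
Hypothesis hP : is_markov_semigroup (gen m lamL lamR) P.
Context (mu : probability (conf N) R).
Hypothesis hmu : stationary P mu.
Implicit Types (f G E U : conf N -> R) (eta : conf N).

Local Notation L := (gen m lamL lamR).

Let sublevel_nd G : nondecreasing_seq (fun n : nat => [set eta | G eta < n%:R]).
Proof.
move=> p q pq; rewrite subsetEset => eta /= h; apply: lt_le_trans h _.
by rewrite ler_nat.
Qed.

Let sublevel_bigcup G : \bigcup_n [set eta | G eta < n%:R] = setT.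
Proof.
apply/seteqP; split => // eta _; exists (Num.truncn (G eta)).+1 => //=.
exact: truncnS_gt.
Qed.

(** On each sublevel set [drift_ge0] bounds the integral of [U] by that of [E], hence by the
    integral of |E| over the whole space; monotone convergence removes the truncation. *)
Lemma drift_integrable G E U : (forall K, finite_set [set eta | G eta < K]) ->
  (forall eta, L G eta <= E eta - U eta) -> (forall eta, 0 <= U eta) ->
  mu.-integrable setT (EFin \o E) -> mu.-integrable setT (EFin \o U).
Proof.
move=> fG hLG U0 iE.
have iabsE : mu.-integrable setT (EFin \o (fun eta => `|E eta|)).
  exact: integrable_abse iE.
apply/integrableP; split; first exact: measurable_fun_conf.
under eq_integral do rewrite /= ger0_norm//.
pose D (n : nat) := [set eta | G eta < n%:R].
have cv : (\int[mu]_(eta in D n) (U eta)%:E)%E @[n --> \oo] --> (\int[mu]_eta (U eta)%:E)%E.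
  rewrite -[X in _ --> (\int[_]_(_ in X) _)%E](sublevel_bigcup G).
  apply: ge0_nondecreasing_set_cvg_integral => //.
  - exact: sublevel_nd.
  - by move=> n eta _; rewrite lee_fin.
apply: (@le_lt_trans _ _ (\int[mu]_eta `|E eta|)%:E); last exact: ltry.
apply: (cvge_to_le cv); apply: nearW => n.
have /finite_seqP[s Es] : finite_set (D n) by exact: fG.
have ii f : mu.-integrable (D n) (EFin \o f) by rewrite Es; exact: integrable_seq.
have h0 := drift_ge0 hm hL hR hP hmu (fG n%:R); rewrite -/(D n) in h0.
have h1 : \int[mu]_(eta in D n) L G eta <=
    \int[mu]_(eta in D n) E eta - \int[mu]_(eta in D n) U eta.
  rewrite -RintegralB//; try exact: ii.
  apply: le_Rintegral => //; exact: ii.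
have h2 : \int[mu]_(eta in D n) E eta <= \int[mu]_(eta in D n) `|E eta|.
  by apply: le_Rintegral => //; try exact: ii; move=> x _; exact: ler_norm.
have h3 : \int[mu]_(eta in D n) `|E eta| <= \int[mu]_eta `|E eta|.
  rewrite /Rintegral fine_le//.
  - exact: integrable_fin_num (ii _).
  - exact: integrable_fin_num iabsE.
  - by apply: ge0_subset_integral.
rewrite -[leLHS]fineK; last exact: integrable_fin_num (ii _).
rewrite lee_fin; rewrite /Rintegral in h0 h1 h2 h3 *; lra.
Qed.

(** Dominated convergence in [drift_ge0] along the sublevel sets at integer heights. *)
Lemma drift_integral_ge0 G : (forall K, finite_set [set eta | G eta < K]) ->
  mu.-integrable setT (EFin \o L G) -> 0 <= \int[mu]_eta L G eta.
Proof.
move=> fG iL.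
pose D (n : nat) := [set eta | G eta < n%:R].
have [_ _ cv] : [/\ mu.-integrable setT (EFin \o L G),
    [sequence \int[mu]_eta `|((EFin \o L G) \_ (D n)) eta - (EFin \o L G) eta|]_n @ \oo --> 0%E
    & [sequence \int[mu]_eta ((EFin \o L G) \_ (D n)) eta]_n @ \oo
      --> \int[mu]_eta (EFin \o L G) eta]%E.
  apply: (dominated_convergence measurableT _ _ _ (integrable_abse iL)).
  - by move=> n; exact: measurable_fun_conf.
  - exact: measurable_fun_conf.
  - apply: aeW => eta _; apply: cvg_near_cst; near=> n.
    rewrite patchE mem_set//= /D /=; near: n.
    exists (Num.truncn (G eta)).+1 => // n /= hn.
    apply: lt_le_trans (truncnS_gt _) _; by rewrite ler_nat.
  - apply: aeW => eta n _; rewrite patchE /=.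
    by case: ifP => // _; rewrite abse0.
rewrite /Rintegral fine_ge0//; apply: (cvge_to_ge cv); apply: nearW => n /=.
rewrite -integral_mkcond -[leRHS]fineK ?lee_fin.
  exact: (drift_ge0 hm hL hR hP hmu (fG n%:R)).
apply: integrable_fin_num; first exact: measurable_conf.
by apply: integrableS iL.
Unshelve. all: by end_near. Qed.

(** By [gen_lyapunov], the moment of order k controls the one of order k + 1 through
    [drift_integrable]. *)
Lemma integrable_growth k : mu.-integrable setT (EFin \o (fun eta => growth eta ^+ k)).
Proof.
elim: k => [|k ih].
  by apply: (@integrable_bounded _ _ _ _ _ 1) => eta _; rewrite expr0 normr1.
have [A A0 hA] := gen_lyapunov (N := N) hm k hL hR.
have iU : mu.-integrable setT (EFin \o (fun eta => 4 * m * (tot eta)%:R ^+ k.+1)).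
  apply: (@drift_integrable (lyapunov m k) (fun eta => A * growth eta ^+ k)) => //.
  - have M0 := weight_end_gt0 (N := N) hm.
    apply: (@finite_sublevel _ _ _ (fun K => K / weight_end N m)) => K eta h.
    rewrite ltr_pdivlMr// mulrC; apply: le_lt_trans h.
    apply: le_trans (lyapunov_ge m k eta); rewrite ler_wpM2l ?(ltW M0)//.
    by rewrite -natrX ler_nat; case: (tot eta) => // n; rewrite -{1}(expn1 n.+1) leq_pexp2l.
  - by move=> eta; rewrite !mulr_ge0// ltW.
  - exact: (integrableZl _ A ih).
(* [c] undoes the factor 4 m in [iU] and supplies the constant of [growth_exp_le_tot]. *)
pose c := 2 ^+ k.+1 * (4 * m)^-1.
have m4 : 0 < 4 * m by rewrite mulr_gt0.
have iG : mu.-integrable setT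
    (EFin \o (fun eta => c * (4 * m * (tot eta)%:R ^+ k.+1) + 2 ^+ k.+1)).
  have ic : mu.-integrable setT (EFin \o (fun=> 2 ^+ k.+1 : R)).
    exact: (@integrable_bounded _ _ _ _ _ `|2 ^+ k.+1|).
  exact: (integrableD measurableT (integrableZl measurableT c iU) ic).
apply: (le_integrable measurableT _ _ iG); first exact: measurable_fun_conf.
move=> eta _ /=; rewrite lee_fin.
rewrite ger0_norm ?exprn_ge0 ?(ltW (growth_gt0 _))//.
apply: le_trans (ler_norm _); apply: (le_trans (growth_exp_le_tot _ _)).
have -> : c * (4 * m * (tot eta)%:R ^+ k.+1) = 2 ^+ k.+1 * (tot eta)%:R ^+ k.+1.
  by rewrite /c -mulrA mulKf// gt_eqF.
by rewrite mulrDr mulr1.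
Qed.

Lemma integrable_poly_bounded f : poly_bounded f -> mu.-integrable setT (EFin \o f).
Proof.
move=> [k [C [C0 h]]].
apply: (@le_integrable _ _ _ _ _ measurableT _ (EFin \o (fun eta => C * growth eta ^+ k))).
- exact: measurable_fun_conf.
- move=> eta _ /=; rewrite lee_fin (le_trans (h eta))// ler_norm//.
- exact: (integrableZl _ C (integrable_growth k)).
Qed.

(** Adding e V^(k+1), of higher degree than the bound on [f], makes all sublevel sets finite for
    every e > 0. The integral is affine in e, and e is then taken small. *)
Let Rintegral_gen_ge0 f : poly_bounded f -> 0 <= \int[mu]_eta L f eta.
Proof.
move=> hf; have [k [C [C0 hC]]] := hf.
pose g eta : R := (tot eta)%:R ^+ k.+1.
have hg : poly_bounded g by exact: poly_boundedX poly_bounded_tot.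
have iL h : poly_bounded h -> mu.-integrable setT (EFin \o L h).
  by move=> hh; apply: integrable_poly_bounded; exact: poly_bounded_gen.
have H e : 0 < e -> 0 <= \int[mu]_eta L f eta + e * \int[mu]_eta L g eta.
  move=> e0; pose G eta := f eta + e * g eta.
  have -> : \int[mu]_eta L f eta + e * \int[mu]_eta L g eta = \int[mu]_eta L G eta.
    rewrite -RintegralZl//; last exact: iL.
    rewrite -RintegralD//; [|exact: iL|exact: (integrableZl _ e (iL _ hg))].
    by apply: eq_Rintegral => eta _; rewrite gen_lin.
  apply: drift_integral_ge0; last first.
    apply: iL; apply: poly_boundedD => //.
    by apply: poly_boundedM => //; exact: poly_bounded_cst.
  pose D := C * 2 ^+ k.
  have D0 : 0 <= D by rewrite mulr_ge0.
  (* Since f >= - D (V^k + 1), the inequality e V >= 2 D + |K| + 1 would give G >= (e V - D) V^k - D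
     >= |K| + 1. *)
  apply: (@finite_sublevel _ _ _ (fun K => (2 * D + `|K| + 1) / e)) => K eta hK.
  rewrite ltNge; apply/negP; rewrite ler_pdivrMr// => hB.
  set v : R := (tot eta)%:R in hB.
  have v0 : 0 <= v by [].
  have K0 : 0 <= `|K| by [].
  have v1 : 1 <= v ^+ k.
    rewrite exprn_ege1// ler1n lt0n; apply/eqP => t0.
    by move: hB; rewrite /v t0 mul0r; lra.
  have fl : - (D * (v ^+ k + 1)) <= f eta.
    rewrite lerNl; apply: (le_trans (ler_norm _)); rewrite normrN.
    apply: (le_trans (hC eta)); rewrite /D -mulrA ler_wpM2l//.
    exact: growth_exp_le_tot.
  have : (D + `|K| + 1) * 1 <= (v * e - D) * v ^+ k by apply: ler_pM; lra.
  have := ler_norm K; move: hK; rewrite /G /g exprS -/v.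
  lra.
rewrite leNgt; apply/negP => a0.
set a := Rintegral _ _ _ in a0 H; set b := Rintegral _ _ _ in H.
have b1 : 0 < 2 * (`|b| + 1) by rewrite mulr_gt0// ltr_wpDl.
(* For this e one has e b <= - a / 2, so a + e b <= a / 2 < 0. *)
have e0 : 0 < - a / (2 * (`|b| + 1)) by rewrite divr_gt0// oppr_gt0.
have := H _ e0; rewrite leNgt => /negP; apply.
have : - a / (2 * (`|b| + 1)) * b <= - a / (2 * (`|b| + 1)) * (`|b| + 1).
  by rewrite ler_wpM2l ?(ltW e0)// (le_trans (ler_norm b))// lerDl.
have -> : - a / (2 * (`|b| + 1)) * (`|b| + 1) = - a / 2.
  by field; rewrite gt_eqF// ltr_wpDl.
lra.
Qed.

Lemma Rintegral_gen f : poly_bounded f -> \int[mu]_eta L f eta = 0.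
Proof.
move=> hf; apply/eqP; rewrite eq_le; apply/andP; split; last exact: Rintegral_gen_ge0.
(* The opposite of [f], in the shape to which [gen_lin] and [gen_cst] apply. *)
have h : poly_bounded (fun eta => 0 + (-1) * f eta).
  apply: poly_boundedD; first exact: poly_bounded_cst.
  by apply: poly_boundedM => //; exact: poly_bounded_cst.
have := Rintegral_gen_ge0 h.
under eq_Rintegral do rewrite gen_lin gen_cst add0r.
rewrite RintegralZl//; last by apply: integrable_poly_bounded; exact: poly_bounded_gen.
lra.
Qed.

End moments.

(** * The absorbing dual *)

Section absorbing.
Context {R : realType} {N : nat} (m rhoL rhoR : R).
Implicit Types (x y l r : site N) (xi : conf N) (h : conf N -> R) (u : site N -> R).

(** Absorbed particles are not recorded: each leaves its factor rho when it is removed, so the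
    particle number can only decrease. *)
Definition gen_absorbing h xi : R := gen_bulk m h xi +
  (xi ord0)%:R * (rhoL * h (remove_at ord0 xi) - h xi) +
  (xi ord_max)%:R * (rhoR * h (remove_at ord_max xi) - h xi).

Definition conf0 : conf N := [ffun=> 0%N].

Lemma tot_eq0 xi : tot xi = 0%N -> xi = conf0.
Proof.
move=> t; apply/ffunP => x; rewrite ffunE.
by apply/eqP; rewrite -leqn0 -t leq_tot.
Qed.

Lemma remove_at_delta x : remove_at x (delta x) = conf0.
Proof. by apply/ffunP => z; rewrite !ffunE subnn. Qed.

Lemma move_delta x y : move x y (delta x) = delta y.
Proof. by apply/ffunP => z; rewrite /move remove_at_delta !ffunE. Qed.

(** A walk of rate [2 m] with absorption at the ends. Its bulk part is a sum over bonds with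
    indicators, to be matched with [gen_bulk] bond by bond. *)
Definition one_particle u x : R :=
  \sum_(b < N) 2 * m * ((x == lsite b)%:R * (u (rsite b) - u (lsite b)) +
                        (x == rsite b)%:R * (u (lsite b) - u (rsite b))) +
  (x == ord0)%:R * (rhoL - u x) + (x == ord_max)%:R * (rhoR - u x).

Lemma gen_absorbing_delta h x : h conf0 = 1 ->
  gen_absorbing h (delta x) = one_particle (fun y => h (delta y)) x.
Proof.
move=> h0; rewrite /gen_absorbing /one_particle !deltaE; congr (_ + _ + _).
- rewrite /gen_bulk; apply: eq_bigr => b _ /=.
  rewrite -/(lsite b) -/(rsite b); have := lsite_neq_rsite b.
  move: (lsite b) (rsite b) => l r lr; rewrite !deltaE.
  have [->|xl] := eqVneq x l.
    by rewrite (negbTE lr) move_delta /=; ring.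
  by have [->|xr] := eqVneq x r; rewrite ?move_delta /=; ring.
- by have [->|] := eqVneq x ord0; rewrite ?mul0r// remove_at_delta h0 mulr1.
- by have [->|] := eqVneq x ord_max; rewrite ?mul0r// remove_at_delta h0 mulr1.
Qed.

Lemma gen_absorbing_lin h h' (c : R) xi :
  gen_absorbing (fun z => h z + c * h' z) xi = gen_absorbing h xi + c * gen_absorbing h' xi.
Proof. rewrite /gen_absorbing gen_bulk_lin; ring. Qed.

Definition prod_fun u xi : R := \prod_(x < N.+1) u x ^+ xi x.

Lemma prod_fun_add_at u x xi : prod_fun u (add_at x xi) = u x * prod_fun u xi.
Proof.
rewrite /prod_fun (bigD1 x)//= [in RHS](bigD1 x)//= add_at_same addn1 exprS -mulrA.
by under eq_bigr => z zx do rewrite (add_at_neq _ zx).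
Qed.

Lemma prod_fun_remove_at u x xi : (0 < xi x)%N ->
  prod_fun u xi = u x * prod_fun u (remove_at x xi).
Proof. by move=> h; rewrite -prod_fun_add_at remove_atK. Qed.

Lemma prod_fun_ge0 u xi : (forall x, 0 <= u x) -> 0 <= prod_fun u xi.
Proof. by move=> u0; apply: prodr_ge0 => x _; rewrite exprn_ge0. Qed.

Let sum_delta (a : site N -> R) l (c : site N -> R) :
  \sum_(x < N.+1) a x * ((x == l)%:R * c x) = a l * c l.
Proof.
rewrite (bigD1 l)//= eqxx mul1r big1 ?addr0// => x /negbTE ->.
by rewrite mul0r mulr0.
Qed.

(* Swapping particles on a bond contributes, beyond independent motion,
   [4 xi_l xi_r (u_r - u_l)^2] times a product. *)
Lemma gen_absorbing_prod_fun_ge0 u xi : (forall x, 0 <= u x) ->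
  (forall x, one_particle u x = 0) -> 0 <= gen_absorbing (prod_fun u) xi.
Proof.
(* [a x] is the partial derivative of the product in u_x; pairing it with [one_particle] gives the
   action of independent motion. *)
move=> u0 hu; pose a x : R := (xi x)%:R * prod_fun u (remove_at x xi).
have aE x : (xi x)%:R * prod_fun u xi = a x * u x.
  rewrite /a; have [->|h] := posnP (xi x); first by rewrite !mul0r.
  by rewrite (prod_fun_remove_at u h); ring.
have am x y : (xi x)%:R * (prod_fun u (move x y xi) - prod_fun u xi) = a x * (u y - u x).
  by rewrite mulrBr aE prod_fun_add_at /a; ring.
(* With both sites occupied, the bracket is xi_l xi_r (u_r - u_l) times the product over the
   remaining particles; otherwise it is 0. *)
have cross l r : l != r ->
    0 <= ((xi r)%:R * a l - (xi l)%:R * a r) * (u r - u l).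
  move=> lr; rewrite /a.
  have [->|hl] := posnP (xi l); first by rewrite !(mul0r, mulr0) subrr mul0r.
  have [->|hr] := posnP (xi r); first by rewrite !(mul0r, mulr0) subrr mul0r.
  have rl : r != l by rewrite eq_sym.
  rewrite (@prod_fun_remove_at u r (remove_at l xi)) ?remove_at_neq//.
  rewrite (@prod_fun_remove_at u l (remove_at r xi)) ?remove_at_neq//.
  have -> : remove_at l (remove_at r xi) = remove_at r (remove_at l xi).
    by apply/ffunP => z; rewrite !ffunE subnAC.
  set g := prod_fun _ _; have g0 : 0 <= g by exact: prod_fun_ge0.
  have -> : ((xi r)%:R * ((xi l)%:R * (u r * g)) - (xi l)%:R * ((xi r)%:R * (u l * g))) *
    (u r - u l) = (xi r)%:R * (xi l)%:R * g * (u r - u l) ^+ 2 by ring.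
  by rewrite mulr_ge0 ?sqr_ge0// !mulr_ge0.
(* Independent motion contributes nothing, so it can be subtracted and the comparison made on each
   bond and at each end; the ends give equality. *)
have zero : \sum_(x < N.+1) a x * one_particle u x = 0.
  by rewrite big1// => x _; rewrite hu mulr0.
rewrite -zero /gen_absorbing.
under eq_bigr do rewrite /one_particle !mulrDr mulr_sumr.
rewrite !big_split /= exchange_big /=.
apply: lerD; [apply: lerD|].
- rewrite /gen_bulk; apply: ler_sum => b _ /=.
  rewrite -/(lsite b) -/(rsite b); have := lsite_neq_rsite b.
  move: (lsite b) (rsite b) => l r lr.
  under eq_bigr do rewrite mulrCA mulrDr.
  rewrite -mulr_sumr big_split /=
    (sum_delta a l (fun=> u r - u l)) (sum_delta a r (fun=> u l - u r)) -subr_ge0.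
  rewrite [leRHS](_ : _ = 4 * (((xi r)%:R * a l - (xi l)%:R * a r) * (u r - u l))).
    by rewrite mulr_ge0// cross.
  transitivity (2 * (m + 2 * (xi r)%:R) * ((xi l)%:R * (prod_fun u (move l r xi) - prod_fun u xi))
    + 2 * (m + 2 * (xi l)%:R) * ((xi r)%:R * (prod_fun u (move r l xi) - prod_fun u xi))
    - 2 * m * (a l * (u r - u l) + a r * (u l - u r))); first by ring.
  by rewrite !am; ring.
- have /= -> := sum_delta a ord0 (fun=> rhoL).
  have /= -> := sum_delta a ord0 (fun x => - u x).
  by rewrite [leRHS]mulrBr aE le_eqVlt; apply/orP; left; apply/eqP; rewrite /a; ring.
- have /= -> := sum_delta a ord_max (fun=> rhoR).
  have /= -> := sum_delta a ord_max (fun x => - u x).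
  by rewrite [leRHS]mulrBr aE le_eqVlt; apply/orP; left; apply/eqP; rewrite /a; ring.
Qed.

End absorbing.

(** * Correlations *)

Lemma seq_argmin {R : realType} (T : eqType) (f : T -> R) (z0 : T) (s : seq T) :
  exists2 z, z \in z0 :: s & forall y, y \in z0 :: s -> f z <= f y.
Proof.
elim: s z0 => [|y s ih] z0.
  by exists z0 => [|y]; rewrite inE// => /eqP ->.
have [z zs hz] := ih y; have [h|h] := leP (f z0) (f z).
  exists z0; rewrite ?inE ?eqxx// => t; rewrite inE => /orP[/eqP -> //|/hz].
  exact: le_trans.
exists z; first by rewrite inE zs orbT.
by move=> t; rewrite inE => /orP[/eqP ->|/hz //]; exact: ltW.
Qed.

(** * Minimum principle for the absorbing dual *)

Section absorbing_comparison.
Context {R : realType} {N : nat} (m rhoL rhoR : R).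
Hypotheses (hm : 0 < m) (hrL : 0 <= rhoL) (hrR : 0 <= rhoR).
Implicit Types (xi : conf N) (h : conf N -> R).

(* Minimum principle, with [lin (weight m)] as a strict supersolution: at a
   configuration minimizing [e / lin (weight m)] over those with [n.+1] particles,
   a negative minimum would force [0 <= - 4 m n.+1]. *)
Lemma gen_absorbing_min (e : conf N -> R) n :
  (forall xi, tot xi = n -> 0 <= e xi) ->
  (forall xi, tot xi = n.+1 -> gen_absorbing m rhoL rhoR e xi <= 0) ->
  forall xi, tot xi = n.+1 -> 0 <= e xi.
Proof.
move=> en eA xi0 t0; rewrite leNgt; apply/negP => neg.
pose s := lin (weight (N := N) m).
have M0 := weight_end_gt0 (N := N) hm.
have s_ge xi : tot xi = n.+1 -> weight_end N m <= s xi.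
  move=> t; apply: (@le_trans _ _ (weight_end N m * (tot xi)%:R)).
    by rewrite t ler_peMr ?ler1n// ltW.
  by apply: lin_ge => x; exact: weight_ge.
have s_gt0 xi : tot xi = n.+1 -> 0 < s xi by move=> /s_ge; exact: lt_le_trans.
have /finite_seqP[r Er] : finite_set [set xi : conf N | tot xi = n.+1].
  by apply: sub_finite_set (finite_tot_le n.+1) => xi /= ->.
have rE xi : (xi \in r) = (tot xi == n.+1).
  have : [set` r] xi = (tot xi = n.+1) :> Prop by rewrite -Er.
  by move=> h; apply/idP/eqP; rewrite -h.
have [z] := seq_argmin (fun xi => e xi / s xi) xi0 r.
set k := e z / s z => zr kmin.
have tz : tot z = n.+1.
  by move: zr; rewrite inE => /orP[/eqP ->//|]; rewrite rE => /eqP.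
have k0 : k < 0.
  apply: le_lt_trans (kmin xi0 (mem_head _ _)) _.
  by rewrite pmulr_llt0// invr_gt0 s_gt0.
have ez : e z = 0 + k * s z by rewrite add0r /k divfK// gt_eqF// s_gt0.
have le xi : tot xi = tot z -> 0 + k * s xi <= e xi.
  rewrite tz => t; rewrite add0r -ler_pdivlMr ?s_gt0//.
  by apply: kmin; rewrite inE rE t eqxx orbT.
have hb := gen_bulk_le hm le (esym ez).
rewrite gen_bulk_lin gen_bulk_weight (_ : gen_bulk m (fun=> 0) z = 0) in hb; last first.
  by rewrite /gen_bulk; apply: big1 => b _ /=; rewrite subrr !mulr0 addr0.
(* Absorption leads to n particles, where [e] is nonnegative, so that gain is dropped and only the
   loss remains. *)
have bd rho (x : site N) : 0 <= rho ->
    - (z x)%:R * e z <= (z x)%:R * (rho * e (remove_at x z) - e z).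
  move=> r0; rewrite mulrBr mulNr lerDr.
  have [->|hx] := posnP (z x); first by rewrite mul0r.
  rewrite !mulr_ge0// en//.
  by move: tz; rewrite (tot_remove_at hx) => -[].
have := eA z tz; rewrite /gen_absorbing.
have bL := bd rhoL ord0 hrL; have bR := bd rhoR ord_max hrR.
rewrite ez add0r in bL bR.
have sz := s_ge z tz.
set a : R := (z ord0)%:R in hb bL bR *; set b : R := (z ord_max)%:R in hb bL bR *.
have ab : 0 <= a + b by rewrite addr_ge0.
set V : R := (tot z)%:R in hb.
have mV : 0 < m * V by rewrite mulr_gt0// /V tz.
(* Together, [hb] and the losses at the ends bound the generator at [z] below by - k (a + b) (s z -
   weight_end) - 4 k m V. As k < 0, the first term is nonnegative and the second positive, against
   [eA]. *)
have h1 : k * ((a + b) * (s z - weight_end N m)) <= 0.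
  by rewrite nmulr_rle0// mulr_ge0// subr_ge0.
have h2 : k * (m * V) < 0 by rewrite pmulr_llt0.
rewrite ez add0r -/a -/b; move: hb; rewrite -/s; lra.
Qed.

Lemma gen_absorbing_prod_le h : h (conf0 (N := N)) = 1 ->
  (forall x, 0 <= h (delta x)) ->
  (forall xi, gen_absorbing m rhoL rhoR h xi = 0) ->
  forall xi, prod_fun (fun x => h (delta x)) xi <= h xi.
Proof.
move=> h0 hu hA xi; set u := fun x => h (delta x).
have : forall n xi, tot xi = n -> 0 <= h xi + (-1) * prod_fun u xi.
  elim => [|n ih] {}xi.
    move=> /tot_eq0 ->; rewrite h0 /prod_fun big1 ?mulN1r ?subrr// => x _.
    by rewrite ffunE.
  apply: (gen_absorbing_min ih) => {}xi _.
  (* The equation for [h] leaves minus the generator of the product. On single particles the same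
     equation says that u solves the one-particle equation. *)
  rewrite gen_absorbing_lin hA add0r mulN1r oppr_le0.
  apply: gen_absorbing_prod_fun_ge0 => // x.
  by rewrite -gen_absorbing_delta.
by move=> /(_ _ xi erefl); rewrite mulN1r subr_ge0.
Qed.

End absorbing_comparison.

#[local] Opaque dual.

(** * Correlation inequalities for the stationary measure *)

Section correlations.
Context {R : realType} {N : nat} (m lamL lamR : R).
Hypotheses (hm : 0 < m) (hL : 0 <= lamL < 1) (hR : 0 <= lamR < 1).
Context (P : R -> conf N -> probability (conf N) R).
Hypothesis hP : is_markov_semigroup (gen m lamL lamR) P.
Context (mu : probability (conf N) R).
Hypothesis hmu : stationary P mu.
Implicit Types (x y : site N) (xi eta : conf N).

Let D xi : R := \int[mu]_eta dual m xi eta.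

Let integrable_dual xi : mu.-integrable setT (EFin \o dual m xi).
Proof. exact: (integrable_poly_bounded hm hL hR hP hmu (poly_bounded_dual hm xi)). Qed.

Let iZ (c : R) (f : conf N -> R) : mu.-integrable setT (EFin \o f) ->
  mu.-integrable setT (EFin \o (fun eta => c * f eta)).
Proof. by move=> h; exact: (integrableZl measurableT c h). Qed.

Let iB (f g : conf N -> R) : mu.-integrable setT (EFin \o f) ->
  mu.-integrable setT (EFin \o g) -> mu.-integrable setT (EFin \o (fun eta => f eta - g eta)).
Proof. by move=> hf hg; exact: (integrableB measurableT hf hg). Qed.

Let iD (f g : conf N -> R) : mu.-integrable setT (EFin \o f) ->
  mu.-integrable setT (EFin \o g) -> mu.-integrable setT (EFin \o (fun eta => f eta + g eta)).
Proof. by move=> hf hg; exact: (integrableD measurableT hf hg). Qed.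

Let RintegralcB (c a : R) (f g : conf N -> R) : mu.-integrable setT (EFin \o f) ->
  mu.-integrable setT (EFin \o g) ->
  \int[mu]_eta (c * (a * f eta - g eta)) = c * (a * \int[mu]_eta f eta - \int[mu]_eta g eta).
Proof.
move=> hf hg; rewrite RintegralZl ?RintegralB ?RintegralZl//; try exact: iZ.
by apply: iB => //; exact: iZ.
Qed.

(** An arbitrary list of bonds is allowed, so that the induction in [Rintegral_bulk] can apply it to
    a tail. *)
Let integrable_bulk xi (r : seq 'I_N) : mu.-integrable setT (EFin \o (fun eta =>
  \sum_(b <- r) (
    2 * (xi (lsite b))%:R * (m + 2 * (xi (rsite b))%:R) *
      (dual m (move (lsite b) (rsite b) xi) eta - dual m xi eta) +
    2 * (xi (rsite b))%:R * (m + 2 * (xi (lsite b))%:R) *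
      (dual m (move (rsite b) (lsite b) xi) eta - dual m xi eta)))).
Proof.
elim: r => [|b r ih].
  under eq_fun do rewrite big_nil.
  by apply: (@integrable_bounded _ _ _ _ _ 0) => eta _; rewrite normr0.
by under eq_fun do rewrite big_cons; apply: iD => //; apply: iD; apply: iZ; exact: iB.
Qed.

Let Rintegral_bulk xi :
  \int[mu]_eta gen_bulk m (fun xi' => dual m xi' eta) xi = gen_bulk m D xi.
Proof.
rewrite /gen_bulk; elim: (index_enum _) => [|b r ih].
  by under eq_Rintegral do rewrite big_nil; rewrite big_nil Rintegral_cst// mul0r.
under eq_Rintegral do rewrite big_cons.
have i1 (c : R) xi' : mu.-integrable setT (EFin \o (fun eta =>
    c * (dual m xi' eta - dual m xi eta))) by apply: iZ; exact: iB.
have E1 (c : R) xi' : \int[mu]_eta (c * (dual m xi' eta - dual m xi eta)) =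
    c * (D xi' - D xi).
  by rewrite RintegralZl//; [rewrite RintegralB|exact: iB].
rewrite big_cons (RintegralD measurableT (iD (i1 _ _) (i1 _ _)) (integrable_bulk xi r)) ih.
rewrite (RintegralD measurableT (i1 _ _) (i1 _ _)).
exact: (congr2 +%R (congr2 +%R (E1 _ _) (E1 _ _)) erefl).
Qed.

Let rhoL := lamL / (1 - lamL).
Let rhoR := lamR / (1 - lamR).

#[local] Transparent dual.

Let gen_absorbing_D xi : gen_absorbing m rhoL rhoR D xi = 0.
Proof.
have [hL1 hR1] : lamL < 1 /\ lamR < 1 by move: hL hR => /andP[_ ?] /andP[_ ?].
rewrite -[RHS](Rintegral_gen hm hL hR hP hmu (poly_bounded_dual hm xi)) /gen.
under eq_Rintegral do rewrite (gen_boundary_dual hm _ _ _ hL1)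
  (gen_boundary_dual hm _ _ _ hR1) (gen_bulk_dual hm).
have ib rho z : mu.-integrable setT (EFin \o (fun eta =>
    (xi z)%:R * (rho * dual m (remove_at z xi) eta - dual m xi eta))).
  by apply: iZ; apply: iB => //; exact: iZ.
rewrite -/rhoL -/rhoR.
rewrite (RintegralD measurableT (iD (ib _ _) (ib _ _)) (integrable_bulk xi (index_enum _))).
rewrite (RintegralD measurableT (ib _ _) (ib _ _)).
rewrite /gen_absorbing -addrA addrC; apply: esym.
have cB := fun z rho => RintegralcB (xi z)%:R rho
  (integrable_dual (remove_at z xi)) (integrable_dual xi).
exact: (congr2 +%R (congr2 +%R (cB _ _) (cB _ _)) (Rintegral_bulk xi)).
Qed.

Lemma dual_conf0 eta : dual m conf0 eta = 1 :> R.
Proof. by rewrite /dual big1// => x _; rewrite ffunE dual10. Qed.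

Let D_conf0 : D conf0 = 1.
Proof.
rewrite /D; under eq_Rintegral do rewrite dual_conf0.
rewrite Rintegral_cst// mul1r. exact: (congr1 fine (probability_setT mu)).
Qed.

Lemma dual_ge0 xi eta : 0 <= dual m xi eta :> R.
Proof. by apply: prodr_ge0 => x _; exact: dual1_ge0. Qed.

Lemma prod_Rintegral_dual_le xi :
  prod_fun (fun x => \int[mu]_eta dual m (delta x) eta) xi <= \int[mu]_eta dual m xi eta.
Proof.
have r0 lam : 0 <= lam < 1 -> 0 <= lam / (1 - lam) :> R.
  by move=> /andP[l0 l1]; rewrite divr_ge0// subr_ge0 ltW.
apply: (@gen_absorbing_prod_le _ _ _ rhoL rhoR hm _ _ D) => //; try exact: r0.
by move=> x; apply: Rintegral_ge0 => eta _; exact: dual_ge0.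
Qed.

Lemma prod_fun_delta_sum (u : site N -> R) n (x : 'I_n -> site N) :
  prod_fun u (delta_sum x) = \prod_(i < n) u (x i).
Proof.
rewrite /prod_fun; under eq_bigr do rewrite ffunE expr_sum.
rewrite exchange_big /=; apply: eq_bigr => i _.
rewrite (bigD1 (x i))//= deltaE eqxx expr1 big1 ?mulr1// => z zx.
by rewrite deltaE eq_sym (negbTE zx).
Qed.

Lemma prod_fun_delta (u : site N -> R) x : prod_fun u (delta x) = u x.
Proof.
rewrite /prod_fun (bigD1 x)//= deltaE eqxx expr1 big1 ?mulr1// => z zx.
by rewrite deltaE eq_sym (negbTE zx).
Qed.

Lemma dual_delta x eta : dual m (delta x) eta = 2 / m * (eta x)%:R.
Proof.
rewrite /dual (bigD1 x)//= big1 ?mulr1; first by rewrite deltaE eqxx dual11.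
by move=> z zx; rewrite deltaE eq_sym (negbTE zx) dual10.
Qed.

Lemma dual_delta2 x y eta : x != y ->
  dual m (add_at x (delta y)) eta = (2 / m) ^+ 2 * ((eta x)%:R * (eta y)%:R).
Proof.
move=> xy; have yx : y != x by rewrite eq_sym.
rewrite /dual (bigD1 x)//= (bigD1 y)//= big1 ?mulr1.
  rewrite add_at_same add_at_neq// !deltaE eqxx (negbTE yx) !dual11//.
  ring.
move=> z /andP[zx zy].
by rewrite add_at_neq// deltaE eq_sym (negbTE zy) dual10.
Qed.

Let integrable_occM x y : mu.-integrable setT (EFin \o (fun eta => (eta x)%:R * (eta y)%:R)).
Proof.
have pb : poly_bounded (fun eta : conf N => (eta x)%:R * (eta y)%:R : R).
  exact: poly_boundedM (poly_bounded_occ x) (poly_bounded_occ y).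
exact: (integrable_poly_bounded hm hL hR hP hmu pb).
Qed.

Let integrable_occ x : mu.-integrable setT (EFin \o (fun eta => (eta x)%:R)).
Proof. exact: (integrable_poly_bounded hm hL hR hP hmu (poly_bounded_occ x)). Qed.

Lemma occ_Lfun x : (occ x : conf N -> R) \in Lfun mu 2%:E.
Proof.
rewrite inE /=; apply/andP; split; rewrite inE /=; first exact: measurable_fun_conf.
rewrite /finite_norm unlock /=; apply: poweR_lty.
under eq_integral => eta _.
  rewrite powR_mulrn// real_normK ?num_real// expr2.
  over.
exact: (integrable_lty measurableT (integrable_occM x x)).
Qed.

(** For [x = y] it is a variance. Otherwise it is the inequality for two particles at distinct
    sites, where both sides carry the factor (2 / m)^2. *)
Lemma covariance_occ_ge0 x y : (0 <= covariance mu (occ x) (occ y))%E.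
Proof.
have [->|xy] := eqVneq x y.
  rewrite unlock; apply: expectation_ge0 => eta /=.
  by rewrite -expr2 sqr_ge0.
have X2 z := occ_Lfun z.
have X1 z : (occ z : conf N -> R) \in Lfun mu 1.
  by apply: Lfun_subset12 => //; exact: fin_num_measure.
rewrite covarianceE//; last exact: Lfun2_mul_Lfun1.
pose a z := \int[mu]_eta ((eta z)%:R : R).
pose c := \int[mu]_eta ((eta x)%:R * (eta y)%:R : R).
have Ea z : expectation mu (occ z) = (a z)%:E.
  rewrite unlock /a /Rintegral fineK//.
  exact: integrable_fin_num (integrable_occ z).
have Ec : expectation mu (occ x * occ y) = c%:E.
  rewrite unlock /c /Rintegral fineK//.
  exact: integrable_fin_num (integrable_occM x y).
rewrite !Ea Ec -EFinM -EFinB lee_fin subr_ge0.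
have m2 : 0 < (2 / m) ^+ 2 by rewrite exprn_gt0// divr_gt0.
have u z : \int[mu]_eta dual m (delta z) eta = 2 / m * a z.
  under eq_Rintegral do rewrite dual_delta.
  by rewrite RintegralZl//; exact: integrable_occ.
have := prod_Rintegral_dual_le (add_at x (delta y)).
under [leRHS]eq_Rintegral do rewrite (dual_delta2 _ xy).
rewrite (RintegralZl ((2 / m) ^+ 2) measurableT (integrable_occM x y)).
rewrite prod_fun_add_at prod_fun_delta !u -/c.
have -> : 2 / m * a x * (2 / m * a y) = (2 / m) ^+ 2 * (a x * a y) by ring.
by rewrite ler_pM2l.
Qed.

End correlations.

Theorem proposition6 (R : realType) (N : nat) (m lamL lamR : R)
    (hm : 0 < m) (hL : 0 <= lamL < 1) (hR : 0 <= lamR < 1)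
    (P : R -> conf N -> probability (conf N) R)
    (hP : is_markov_semigroup (gen m lamL lamR) P)
    (mu : probability (conf N) R) (hmu : stationary P mu) :
  (forall (n : nat) (x : 'I_n -> 'I_N.+1), (1 <= n)%N ->
     mu.-integrable setT (EFin \o dual m (delta_sum x)) /\
     \int[mu]_eta dual m (delta_sum x) eta >=
       \prod_(i < n) \int[mu]_eta dual m (delta (x i)) eta) /\
  (forall x y : 'I_N.+1,
     [/\ (occ x : conf N -> R) \in Lfun mu 2%:E,
         (occ y : conf N -> R) \in Lfun mu 2%:E &
         (0 <= covariance mu (occ x) (occ y))%E]).
Proof.
split => [n x _|x y].
  split.
    exact: (integrable_poly_bounded hm hL hR hP hmu (poly_bounded_dual hm _)).
  have := prod_Rintegral_dual_le hm hL hR hP hmu (delta_sum x).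
  by rewrite prod_fun_delta_sum.
split; [exact: (occ_Lfun hm hL hR hP hmu x)|exact: (occ_Lfun hm hL hR hP hmu y)|].
exact: (covariance_occ_ge0 hm hL hR hP hmu x y).
Qed.
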